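(* Consider the nonmonotone Levenberg--Marquardt algorithm for $\min_{x\in\mathbb{R}^d}\frac12\|F(x)\|^2$ subject to $C(x)=0$ described in the context, and suppose that assumptions (A1)--(A4) of the context hold and that the algorithm does not terminate finitely. Then the sequence of iterates of the algorithm is such that $\liminf_{j\to+\infty}\|\widetilde W_j(g_j)\|=0$.
   Context: **Problem and notation.** $\|\cdot\|$ is the Euclidean vector norm or the matrix $\ell_2$-norm, $\langle\cdot,\cdot\rangle$ the dot product. $F:\mathbb{R}^d\to\mathbb{R}^m$ and $C:\mathbb{R}^d\to\mathbb{R}^p$ have Jacobians $J^F(x)$, $J^c(x)$. Put $f(x)=\frac12\|F(x)\|^2$, $\phi(x)=\frac12\|C(x)\|^2$, $\mathcal{L}(x,y)=f(x)+y^\top C(x)$. At the iterate $x_j$ write $F_j=F(x_j)$, $C_j=C(x_j)$, $J^F_j=J^F(x_j)$, $J^c_j=J^c(x_j)$. $W_j\in\mathbb{R}^{d\times d}$ is the projection matrix onto the null space of $J^c_j$, with $W_j=W_j^\top=W_j^2$. $\gamma_j>0$ is a regularization parameter and $y_j\in\mathbb{R}^p$ a Lagrange multiplier estimate. **Constants.** $\rho_1,\rho_2\in(0,1)$; $0<\hat\gamma_1<1<\hat\gamma_2$; $\gamma_{\min}>0$; $0<\alpha,\beta<1/2$; $2/3<\xi<1$; $\kappa_1,\kappa_2,\xi_0,\xi_1,\xi_2>0$; positive integers $\nu,\nu^l$; $\mu\in(0,1/m)$; $\alpha_0\in(0,1)$; a fixed $\eta$ with $4/3<\eta<4$; a sequence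 $\{a_k\}_{k\ge0}$ with $a_k>0$, $\alpha_0\le a_{k+1}/a_k<1$, $\lim_k a_k=0$, $\sum_k a_k^\eta=\infty$. **Quantities and conditions on the steps.** Quasi-normal step: with $m^c_j(n)=\frac12\|C_j+J^c_jn\|^2+\frac12\gamma_j\|n\|^2$, $n_j$ is an approximate (possibly exact) minimizer of $m^c_j$, required to satisfy (N) $m^c_j(0)-m^c_j(n_j)\ge\kappa_1\|C_j\|^2/(\|J^c_j\|^2+\gamma_j)$. Let $H_j=(J^F_j)^\top J^F_j+\gamma_jI_d$, $\nabla\mathcal{L}_j=(J^F_j)^\top F_j+(J^c_j)^\top y_j$, $g_j=\nabla\mathcal{L}_j+H_jn_j$. $\widetilde W_j(\cdot)$ is an approximation of the application of $W_j$, required to satisfy (W) $\|\widetilde W_j(n_j)-W_jn_j\|\le\xi_0/\gamma_j^2$ and $\|\widetilde W_j(g_j)-W_jg_j\|\le\xi_1/\gamma_j$. Write $\hat g_j=\widetilde W_j(g_j)$. Inexact tangential step: $\widetilde t_j=\widetilde W_j(w_j)$ is an approximate (possibly exact) solution of $\min_{\widetilde t}\frac12\langle H_j\widetilde t,\widetilde t\rangle+\langle\widetilde W_j(g_j),\widetilde t\rangle$, over vectors of the form $\widetilde t=\widetilde W_j(w)$, $w\in\mathbb{R}^d$. With $\mathrm{pred}^t_j=-\frac12\langle H_j\widetilde t_j,\widetilde t_j\rangle-\langle\widetilde W_j(g_j),\widetilde t_j\rangle$, it is required to satisfy (T) $\mathrm{pred}^t_j\ge\kappa_2\|\widetilde W_j(g_j)\|^2/(\|J^F_j\|^2+\gamma_j)$.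 The vector $t_j$ is required to satisfy (P) $\|t_j-W_j\widetilde t_j\|\le\xi_2/\gamma_j^2$. Put $\widetilde s_j=n_j+\widetilde t_j$ and $s_j=n_j+t_j$. Reductions: $\mathrm{pred}^c_j=\phi(x_j)-m^c_j(n_j)$; $\mathrm{ared}^c_j=\phi(x_j)-\phi(x_j+s_j)$; $\mathrm{rared}^c_j=\frac12\max\{R_j,\sum_{k=0}^{\nu^c_j-1}\mu^c_{jk}\|C_{j-k}\|^2\}-\frac12\|C(x_j+s_j)\|^2$; $\mathrm{pred}^l_j=-\frac12\langle H_jn_j,n_j\rangle-\langle\nabla\mathcal{L}_j,n_j\rangle+\mathrm{pred}^t_j+\frac12\langle\gamma_jt_j+g_j,n_j-\widetilde W_j(n_j)\rangle$; $\mathrm{ared}^l_j=\mathcal{L}(x_j,y_j)-\mathcal{L}(x_j+s_j,y_j)$; $\mathrm{rared}^l_j=\max\{\mathcal{L}(x_j,y_j),\sum_{k=0}^{\nu^l_j-1}\mu^l_{jk}\mathcal{L}(x_{j-k},y_{j-k})\}-\mathcal{L}(x_j+s_j,y_j)$. Here $\nu^c_j=\min(j+1,\nu)$, $\nu^l_j=\min(j+1,\nu^l)$, $\mu^c_{jk}\ge\mu$, $\mu^l_{jk}\ge\mu$, $\sum_{k=0}^{\nu^c_j-1}\mu^c_{jk}=1$, $\sum_{k=0}^{\nu^l_j-1}\mu^l_{jk}=1$, and $R_j\ge\|C_j\|^2$ is defined in Step 2. **Algorithm.** Choose $x_0$, $\gamma_0>0$ and set $k_0=0$. For $j=0,1,\dots$: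 Step 1: evaluate $F_j,J^F_j,C_j,J^c_j,g_j$ and a Lagrange multiplier estimate $y_j$. Step 2: choose the weights $\mu^c_{jk}$, $\mu^l_{jk}$ and update $R_j$ as follows. If $\|C_j\|<\min\{\alpha a_{k_j},\beta\|\hat g_j\|\}$, set $R_j=\min\{a_{k_j}^2,\|\hat g_j\|^2\}$, and set $k_{j+1}=k_j+1$ if $R_j\ge\sum_{k=0}^{\nu^c_j-1}\mu^c_{jk}\|C_{j-k}\|^2$, $k_{j+1}=k_j$ otherwise. Else set $R_j=\|C_j\|^2$ and $k_{j+1}=k_j$. Step 3: compute $n_j$ such that (N) holds and $\widetilde t_j$ satisfying (W) and (T); set $\widetilde s_j=n_j+\widetilde t_j$. Step 4: compute $t_j$ satisfying (P) and set $s_j=n_j+t_j$. Step 5: if $\mathrm{pred}^t_j\ge\max\{\mathrm{pred}^c_j,(\mathrm{pred}^c_j)^\xi\}$ and $\mathrm{pred}^l_j\ge\rho_2\mathrm{pred}^t_j$, the step is accepted when both $\mathrm{rared}^c_j\ge\rho_1\mathrm{pred}^c_j$ and $\mathrm{rared}^l_j\ge\rho_1\mathrm{pred}^l_j$, and rejected otherwise. In the remaining case the step is accepted when $\mathrm{rared}^c_j\ge\rho_1\mathrm{pred}^c_j$, and rejected otherwise. On acceptance, set $x_{j+1}=x_j+s_j$, replace the regularization parameter by $\max(\gamma_{\min},\hat\gamma_1\gamma_j)$, and pass to iteration $j+1$ with this value. On rejection, replace $\gamma_j$ by $\hat\gamma_2\gamma_j$ and go to Step 4. **Assumptions.** (A1)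 The sequence $\{x_j,x_j+s_j\}$ lies in a compact set $\Omega$. (A2) $F$ and $C$ are continuously differentiable (thus so is $\phi$), and the gradients of $f$, $\phi$ and each component $C_i$ of $C$ are Lipschitz continuous. (A3) There exist $\kappa^c_{JJ}>0$ and $\kappa_W>0$ such that for every index $j$, $\|(J^c_j(J^c_j)^\top)^{-1}\|\le\kappa^c_{JJ}$ and $\|\widetilde W_j(x)\|\le\kappa_W\|x\|$ for any $x$. (A4) There exists $\kappa_y>0$ such that $\|y_j\|\le\kappa_y$ for every $j$.
   Formalization: Conditions (N), (W), (T), (P) are required for the current γ_j at every trial, including after each rejection; n_j and the tangential step may then be recomputed, and ĝ_j, R_j and the predictions use the current γ_j; the liminf is taken over accepted trials. *)

(* Defs.v *)
(* Vectors of R^n are columns 'cV[R]_n. *)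
From HB Require Import structures.
From mathcomp Require Import all_boot all_order all_algebra.
From mathcomp Require Import all_classical all_reals all_analysis.

Set Implicit Arguments.
Unset Strict Implicit.
Unset Printing Implicit Defensive.

Import Order.TTheory GRing.Theory Num.Theory.
Import numFieldNormedType.Exports.

Local Open Scope classical_set_scope.
Local Open Scope ring_scope.

(* The library norm `|_| on matrices is the sup norm, hence the following. *)

Definition dotv (R : realType) (n : nat) (u v : 'cV[R]_n) : R :=
  \sum_(i < n) u i ord0 * v i ord0.

Definition enorm (R : realType) (n : nat) (v : 'cV[R]_n) : R :=
  Num.sqrt (dotv v v).

Definition opnorm (R : realType) (q n : nat) (A : 'M[R]_(q, n)) : R :=
  sup [set enorm (A *m v) | v in [set v : 'cV[R]_n | enorm v <= 1]].

(* Unlike the library's 'J, which acts on row vectors from the right, the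
   Jacobian here has the usual shape: 'd G x v = jac G x *m v. *)
Definition jac (R : realType) (n q : nat) (G : 'cV[R]_n -> 'cV[R]_q)
    (x : 'cV[R]_n) : 'M[R]_(q, n) :=
  \matrix_(i < q, j < n) ('d G x (delta_mx j ord0 : 'cV[R]_n)) i ord0.

Definition grad (R : realType) (n : nat) (g : 'cV[R]_n -> R)
    (x : 'cV[R]_n) : 'cV[R]_n :=
  \col_(i < n) 'd g x (delta_mx i ord0 : 'cV[R]_n).

Definition continuously_differentiable (R : realType) (n q : nat)
    (G : 'cV[R]_n -> 'cV[R]_q) : Prop :=
  (forall x, differentiable G x) /\ continuous (jac G).

Definition lipschitz_field (R : realType) (n q : nat)
    (G : 'cV[R]_n -> 'cV[R]_q) : Prop :=
  exists L : R, forall u v, enorm (G u - G v) <= L * enorm (u - v).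

Definition null_projector (R : realType) (q n : nat) (J : 'M[R]_(q, n))
    (W : 'M[R]_n) : Prop :=
  [/\ W^T = W, W *m W = W
    & forall v : 'cV[R]_n, J *m v = 0 <-> W *m v = v].

Definition half_sq (R : realType) (n q : nat) (G : 'cV[R]_n -> 'cV[R]_q)
    (x : 'cV[R]_n) : R :=
  2^-1 * enorm (G x) ^+ 2.

Record constants (R : realType) := Constants {
  rho1 : R; rho2 : R;
  ghat1 : R; ghat2 : R; gmin : R;
  alpha : R; beta : R; xi : R;
  kappa1 : R; kappa2 : R;
  xi0 : R; xi1 : R; xi2 : R;
  nuc : nat; nul : nat;
  mu : R; alpha0 : R; eta : R;
  a_ : nat -> R
}.

Definition admissible_sequence (R : realType) (alpha0 eta : R)
    (a : nat -> R) : Prop :=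
  [/\ forall k, 0 < a k,
      forall k, alpha0 <= a k.+1 / a k < 1,
      a k @[k --> \oo] --> 0
    & (\sum_(0 <= i < k) a i `^ eta) @[k --> \oo] --> +oo].

Definition valid_constants (R : realType) (m : nat) (c : constants R) : Prop :=
  [/\ [/\ 0 < rho1 c < 1 & 0 < rho2 c < 1],
      [/\ 0 < ghat1 c < 1, 1 < ghat2 c & 0 < gmin c],
      [/\ 0 < alpha c < 2^-1, 0 < beta c < 2^-1 & 2 / 3 < xi c < 1],
      [/\ 0 < kappa1 c, 0 < kappa2 c, 0 < xi0 c, 0 < xi1 c & 0 < xi2 c]
    & [/\ (0 < nuc c)%N, (0 < nul c)%N, 0 < mu c < m%:R^-1, 0 < alpha0 c < 1
        & 4 / 3 < eta c < 4 /\ admissible_sequence (alpha0 c) (eta c) (a_ c)]].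

(* Trial i of iteration j is the pass through the acceptance test that follows
   i rejections; iteration j ends with the acceptance of trial rej j, so that
   every loop over rejections is finite and the run infinite.  A rejection
   changes the regularization parameter, and with it every quantity defined
   from it; the step conditions are imposed for the current parameter gam j i.
   The quantities carrying the single index j in the mathematical notation are
   those of the current trial and, once iteration j is over, those of trial
   rej j. *)
Record run (R : realType) (d p : nat) := Run {
  x_ : nat -> 'cV[R]_d;
  y_ : nat -> 'cV[R]_p;
  W_ : nat -> 'M[R]_d;
  mu_c : nat -> nat -> R;
  mu_l : nat -> nat -> R;
  k_ : nat -> nat;
  rej : nat -> nat;
  gam : nat -> nat -> R;
  n_ : nat -> nat -> 'cV[R]_d;
  (* the inexact projection; not assumed linear *)
  Wt : nat -> nat -> 'cV[R]_d -> 'cV[R]_d;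
  tt_ : nat -> nat -> 'cV[R]_d; (* \widetilde t *)
  t_ : nat -> nat -> 'cV[R]_d
}.

Section Algorithm.
Variables (R : realType) (d m p : nat).
Variables (F : 'cV[R]_d -> 'cV[R]_m) (C : 'cV[R]_d -> 'cV[R]_p).
Variables (c : constants R) (r : run R d p).
Implicit Types i j k : nat.

Definition lagrangian (x : 'cV[R]_d) (y : 'cV[R]_p) : R :=
  half_sq F x + dotv y (C x).

Definition JF j : 'M[R]_(m, d) := jac F (x_ r j).
Definition Jc j : 'M[R]_(p, d) := jac C (x_ r j).

Definition model_c j i (n : 'cV[R]_d) : R :=
  2^-1 * enorm (C (x_ r j) + Jc j *m n) ^+ 2
  + 2^-1 * gam r j i * enorm n ^+ 2.

Definition Hmat j i : 'M[R]_d := (JF j)^T *m JF j + (gam r j i)%:M.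

Definition gradL j : 'cV[R]_d :=
  (JF j)^T *m F (x_ r j) + (Jc j)^T *m y_ r j.

Definition gvec j i : 'cV[R]_d := gradL j + Hmat j i *m n_ r j i.

Definition ghat j i : 'cV[R]_d := Wt r j i (gvec j i).

Definition step j i : 'cV[R]_d := n_ r j i + t_ r j i.

Definition pred_t j i : R :=
  - (2^-1 * dotv (Hmat j i *m tt_ r j i) (tt_ r j i)) - dotv (ghat j i) (tt_ r j i).

Definition pred_c j i : R :=
  half_sq C (x_ r j) - model_c j i (n_ r j i).

Definition pred_l j i : R :=
  - (2^-1 * dotv (Hmat j i *m n_ r j i) (n_ r j i))
  - dotv (gradL j) (n_ r j i)
  + pred_t j i
  + 2^-1 * dotv (gam r j i *: t_ r j i + gvec j i)
                (n_ r j i - Wt r j i (n_ r j i)).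

Definition win_c j : nat := minn j.+1 (nuc c).
Definition win_l j : nat := minn j.+1 (nul c).

Definition avg_c j : R :=
  \sum_(0 <= k < win_c j) mu_c r j k * enorm (C (x_ r (j - k)%N)) ^+ 2.

Definition avg_l j : R :=
  \sum_(0 <= k < win_l j)
     mu_l r j k * lagrangian (x_ r (j - k)%N) (y_ r (j - k)%N).

Definition relaxed j i : bool :=
  enorm (C (x_ r j)) <
    Num.min (alpha c * a_ c (k_ r j)) (beta c * enorm (ghat j i)).

Definition Rj j i : R :=
  if relaxed j i then Num.min (a_ c (k_ r j) ^+ 2) (enorm (ghat j i) ^+ 2)
  else enorm (C (x_ r j)) ^+ 2.

Definition rared_c j i : R :=
  2^-1 * Num.max (Rj j i) (avg_c j)
  - 2^-1 * enorm (C (x_ r j + step j i)) ^+ 2.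

Definition rared_l j i : R :=
  Num.max (lagrangian (x_ r j) (y_ r j)) (avg_l j)
  - lagrangian (x_ r j + step j i) (y_ r j).

Definition cond_N j i : Prop :=
  model_c j i 0 - model_c j i (n_ r j i) >=
  kappa1 c * enorm (C (x_ r j)) ^+ 2 / (opnorm (Jc j) ^+ 2 + gam r j i).

Definition cond_W j i : Prop :=
  enorm (Wt r j i (n_ r j i) - W_ r j *m n_ r j i)
    <= xi0 c / gam r j i ^+ 2 /\
  enorm (Wt r j i (gvec j i) - W_ r j *m gvec j i) <= xi1 c / gam r j i.

Definition cond_T j i : Prop :=
  (exists w : 'cV[R]_d, tt_ r j i = Wt r j i w) /\
  pred_t j i >=
  kappa2 c * enorm (ghat j i) ^+ 2 / (opnorm (JF j) ^+ 2 + gam r j i).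

Definition cond_P j i : Prop :=
  enorm (t_ r j i - W_ r j *m tt_ r j i) <= xi2 c / gam r j i ^+ 2.

(* The power is the usual one: pred_c j i >= 0 by cond_N. *)
Definition tangential_test j i : bool :=
  (Num.max (pred_c j i) (pred_c j i `^ xi c) <= pred_t j i) &&
  (rho2 c * pred_t j i <= pred_l j i).

Definition accepted j i : bool :=
  (rho1 c * pred_c j i <= rared_c j i) &&
  (tangential_test j i ==> (rho1 c * pred_l j i <= rared_l j i)).

Definition valid_weights j : Prop :=
  [/\ forall k, (k < win_c j)%N -> mu c <= mu_c r j k,
      forall k, (k < win_l j)%N -> mu c <= mu_l r j k,
      \sum_(0 <= k < win_c j) mu_c r j k = 1
    & \sum_(0 <= k < win_l j) mu_l r j k = 1].

Definition valid_trial j i : Prop :=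
  [/\ cond_N j i, cond_W j i, cond_T j i & cond_P j i].

Definition lm_run : Prop :=
  [/\ 0 < gam r 0%N 0%N, k_ r 0%N = 0%N
    & forall j,
      [/\ null_projector (Jc j) (W_ r j),
          valid_weights j,
          forall i, (i <= rej r j)%N -> valid_trial j i,
          forall i, (i < rej r j)%N ->
            ~~ accepted j i /\ gam r j i.+1 = ghat2 c * gam r j i
        & accepted j (rej r j) /\
          [/\ x_ r j.+1 = x_ r j + step j (rej r j),
              gam r j.+1 0%N = Num.max (gmin c) (ghat1 c * gam r j (rej r j))
            & k_ r j.+1 = (if relaxed j (rej r j)
                              && (avg_c j <= Rj j (rej r j))
                           then (k_ r j).+1 else k_ r j)]]].

(* The trial points include the rejected ones. *)
Definition assumption_A1 : Prop :=
  exists Omega : set 'cV[R]_d,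
    compact Omega /\
    forall j, Omega (x_ r j) /\
      forall i, (i <= rej r j)%N -> Omega (x_ r j + step j i).

Definition assumption_A2 : Prop :=
  [/\ continuously_differentiable F, continuously_differentiable C,
      lipschitz_field (grad (half_sq F)), lipschitz_field (grad (half_sq C))
    & forall q : 'I_p, lipschitz_field (grad (fun x => C x q ord0))].

Definition assumption_A3 : Prop :=
  exists kJJ kW : R,
    [/\ 0 < kJJ, 0 < kW
      & forall j,
        [/\ Jc j *m (Jc j)^T \in unitmx,
            opnorm (invmx (Jc j *m (Jc j)^T)) <= kJJ
          & forall i, (i <= rej r j)%N ->
              forall v, enorm (Wt r j i v) <= kW * enorm v]].

Definition assumption_A4 : Prop :=
  exists ky : R, 0 < ky /\ forall j, enorm (y_ r j) <= ky.

End Algorithm.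

(* Main.v *)
Require Import Defs.
From HB Require Import structures.
From mathcomp Require Import all_boot all_order all_algebra.
From mathcomp Require Import all_classical all_reals all_analysis.
From mathcomp Require Import ring lra zify.

Set Implicit Arguments.
Unset Strict Implicit.
Unset Printing Implicit Defensive.

Import Order.TTheory GRing.Theory Num.Theory.
Import numFieldNormedType.Exports.

Local Open Scope classical_set_scope.
Local Open Scope ring_scope.

(* Suppose |ghat| >= eps along the accepted trials from some index on.  Uniformly
   over all trials, n = O(|C|/gamma) and tt, t = O(1/gamma), since H >= gamma I;
   Taylor expansion then bounds the gaps between predicted and actual reductions
   by O(|C|/gamma + 1/gamma^2), and those of the constraint reduction by
   O(|C|/gamma^2 + 1/gamma^4).  Every trial with gamma >= const/a_k is therefore
   accepted, and gamma = O(1/a_k).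
   If k were eventually constant, gamma would stay bounded and C -> 0 linearly
   along windows, which would force k to increase.  So k increases infinitely
   often, and every increase caps all later values of |C| by a multiple of a_k;
   hence C -> 0 again.  Once C is small, every step makes f drop below its value
   at some iterate of the window by at least const * a_k: for large gamma by the
   Taylor expansion alone, for bounded gamma because the tangential test holds
   and f and the Lagrangian differ by O(|C|).  Since sum a_k diverges (because
   sum a_k^eta does, with a_k bounded and eta > 1), f would be unbounded below. *)

(** * Euclidean inner product, norm and operator norm *)

Section EuclideanNorm.
Variable R : realType.
Implicit Types n q : nat.

Lemma dotvE n (u v : 'cV[R]_n) : dotv u v = (u^T *m v) 0 0.
Proof. by rewrite mxE; apply: eq_bigr => i _; rewrite mxE. Qed.

Lemma dotvC n (u v : 'cV[R]_n) : dotv u v = dotv v u.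
Proof. by apply: eq_bigr => i _; rewrite mulrC. Qed.

Lemma dotvDl n (u v w : 'cV[R]_n) : dotv (u + v) w = dotv u w + dotv v w.
Proof. by rewrite -big_split; apply: eq_bigr => i _; rewrite mxE mulrDl. Qed.

Lemma dotvDr n (u v w : 'cV[R]_n) : dotv w (u + v) = dotv w u + dotv w v.
Proof. by rewrite dotvC dotvDl !(dotvC w). Qed.

Lemma dotvZl n a (u v : 'cV[R]_n) : dotv (a *: u) v = a * dotv u v.
Proof. by rewrite /dotv mulr_sumr; apply: eq_bigr => i _; rewrite mxE mulrA. Qed.

Lemma dotvZr n a (u v : 'cV[R]_n) : dotv u (a *: v) = a * dotv u v.
Proof. by rewrite dotvC dotvZl dotvC. Qed.

Lemma dotvNl n (u v : 'cV[R]_n) : dotv (- u) v = - dotv u v.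
Proof. by rewrite -scaleN1r dotvZl mulN1r. Qed.

Lemma dotvNr n (u v : 'cV[R]_n) : dotv u (- v) = - dotv u v.
Proof. by rewrite dotvC dotvNl dotvC. Qed.

Lemma dotvBl n (u v w : 'cV[R]_n) : dotv (u - v) w = dotv u w - dotv v w.
Proof. by rewrite dotvDl dotvNl. Qed.

Lemma dotvBr n (u v w : 'cV[R]_n) : dotv w (u - v) = dotv w u - dotv w v.
Proof. by rewrite dotvDr dotvNr. Qed.

Lemma dotv_mull n q (A : 'M[R]_(q, n)) u v :
  dotv (A *m u) v = dotv u (A^T *m v).
Proof. by rewrite !dotvE trmx_mul mulmxA. Qed.

Lemma dotv_ge0 n (u : 'cV[R]_n) : 0 <= dotv u u.
Proof. by apply: sumr_ge0 => i _; rewrite -expr2 sqr_ge0. Qed.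

Lemma enorm_ge0 n (u : 'cV[R]_n) : 0 <= enorm u.
Proof. exact: sqrtr_ge0. Qed.

Lemma enorm_sqr n (u : 'cV[R]_n) : enorm u ^+ 2 = dotv u u.
Proof. by rewrite sqr_sqrtr ?dotv_ge0. Qed.

Lemma enorm0 n : enorm (0 : 'cV[R]_n) = 0.
Proof.
by rewrite /enorm /dotv big1 ?sqrtr0 // => i _; rewrite mxE mul0r.
Qed.

Lemma enorm0_eq0 n (u : 'cV[R]_n) : enorm u = 0 -> u = 0.
Proof.
move=> u0; have /eqP : dotv u u = 0 by rewrite -enorm_sqr u0 expr0n.
rewrite psumr_eq0 => [/allP h|i _]; last by rewrite -expr2 sqr_ge0.
apply/matrixP => i j; rewrite mxE ord1.
by have := h i (mem_index_enum _); rewrite /= mulf_eq0 orbb => /eqP.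
Qed.

Lemma enormZ n a (u : 'cV[R]_n) : enorm (a *: u) = `|a| * enorm u.
Proof.
by rewrite /enorm dotvZl dotvZr mulrA -expr2 sqrtrM ?sqr_ge0// sqrtr_sqr.
Qed.

Lemma enormN n (u : 'cV[R]_n) : enorm (- u) = enorm u.
Proof. by rewrite -scaleN1r enormZ normrN1 mul1r. Qed.

Lemma enormB_sym n (u v : 'cV[R]_n) : enorm (u - v) = enorm (v - u).
Proof. by rewrite -enormN opprB. Qed.

(** Cauchy-Schwarz, from the nonnegative square of [enorm v *: u - enorm u *: v]. The final division
    by both norms is why zero vectors are treated apart. *)
Lemma dotv_le n (u v : 'cV[R]_n) : dotv u v <= enorm u * enorm v.
Proof.
have [/eqP u0|u0] := boolP (enorm u == 0).
  rewrite u0 mul0r (enorm0_eq0 u0) /dotv big1// => i _.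
  by rewrite mxE mul0r.
have [/eqP v0|v0] := boolP (enorm v == 0).
  rewrite v0 mulr0 (enorm0_eq0 v0) /dotv big1// => i _.
  by rewrite mxE mulr0.
have uP : 0 < enorm u by rewrite lt_def u0 enorm_ge0.
have vP : 0 < enorm v by rewrite lt_def v0 enorm_ge0.
have := dotv_ge0 (enorm v *: u - enorm u *: v).
rewrite dotvBl !dotvBr !dotvZl !dotvZr -!enorm_sqr (dotvC v u).
set a := enorm u in uP *; set b := enorm v in vP *; set e := dotv u v => h.
have : 0 <= (a * b * 2) * (a * b - e) by move: h; lra.
by rewrite pmulr_rge0 ?subr_ge0// !mulr_gt0.
Qed.

Lemma normr_dotv_le n (u v : 'cV[R]_n) : `|dotv u v| <= enorm u * enorm v.
Proof.
rewrite ler_norml dotv_le andbT lerNl -dotvNl -(enormN u).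
exact: dotv_le.
Qed.

Lemma ler_enormD n (u v : 'cV[R]_n) : enorm (u + v) <= enorm u + enorm v.
Proof.
rewrite -(@ler_pXn2r _ 2) ?nnegrE ?addr_ge0 ?enorm_ge0//.
rewrite enorm_sqr dotvDl !dotvDr -!enorm_sqr (dotvC v u).
by have := dotv_le u v; lra.
Qed.

Lemma ler_enormB n (u v : 'cV[R]_n) : enorm (u - v) <= enorm u + enorm v.
Proof. by have := ler_enormD u (- v); rewrite enormN. Qed.

(** Symmetry and idempotence give |Wv|^2 = <v, Wv>, and Cauchy-Schwarz cancels one factor |Wv|. *)
Lemma enorm_projector n (W : 'M[R]_n) v :
  W^T = W -> W *m W = W -> enorm (W *m v) <= enorm v.
Proof.
move=> WT WW; have [w0|w0] := leP (enorm (W *m v)) 0.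
  exact: le_trans w0 (enorm_ge0 _).
rewrite -(@ler_pM2l _ (enorm (W *m v)))// -expr2 enorm_sqr.
rewrite dotv_mull WT mulmxA WW mulrC; exact: dotv_le.
Qed.

Lemma enorm_coord n (v : 'cV[R]_n) i : `|v i ord0| <= enorm v.
Proof.
rewrite -sqrtr_sqr ler_wsqrtr// /dotv (bigD1 i)//= -expr2 lerDl.
by apply: sumr_ge0 => k _; rewrite -expr2 sqr_ge0.
Qed.

Lemma enorm_le_sum n (v : 'cV[R]_n) : enorm v <= \sum_i `|v i ord0|.
Proof.
have s0 : 0 <= \sum_i `|v i ord0| by apply: sumr_ge0.
rewrite -(@ler_pXn2r _ 2) ?nnegrE ?enorm_ge0// enorm_sqr expr2 mulr_suml.
apply: ler_sum => i _; apply: le_trans (ler_norm _) _; rewrite normrM.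
by rewrite ler_wpM2l// (bigD1 i)//= lerDl sumr_ge0.
Qed.

Lemma enorm_le_coord n (v : 'cV[R]_n) K :
  (forall i, `|v i ord0| <= K) -> enorm v <= n%:R * K.
Proof.
move=> h; apply: le_trans (enorm_le_sum _) _.
apply: le_trans (ler_sum _ (fun i _ => h i)) _.
by rewrite sumr_const card_ord mulr_natl.
Qed.

Lemma enorm_mulmx_le q n (A : 'M[R]_(q, n)) K v :
  (forall i j, `|A i j| <= K) -> enorm (A *m v) <= q%:R * (n%:R * K) * enorm v.
Proof.
move=> h; rewrite -mulrA; apply: enorm_le_coord => i; rewrite mxE.
apply: le_trans (ler_norm_sum _ _ _) _.
have -> : n%:R * K * enorm v = \sum_(i < n) K * enorm v.
  by rewrite sumr_const card_ord -mulrA mulr_natl.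
by apply: ler_sum => k _; rewrite normrM ler_pM// enorm_coord.
Qed.

(** The absolute value covers a negative [K], which the premise allows when [n] is zero. *)
Lemma opnorm_le q n (A : 'M[R]_(q, n)) K :
  (forall v, enorm (A *m v) <= K * enorm v) -> opnorm A <= `|K|.
Proof.
move=> h; apply: ge_sup.
  by exists (enorm (A *m 0)), 0 => //=; rewrite enorm0 ler01.
move=> _ [v /= v1 <-]; apply: le_trans (h v) _.
apply: le_trans (ler_norm _) _.
by rewrite normrM ler_piMr// ger0_norm ?enorm_ge0.
Qed.

Lemma opnorm_ge0 q n (A : 'M[R]_(q, n)) : 0 <= opnorm A.
Proof.
rewrite /opnorm; set S := (X in sup X).
have S0 : S 0 by exists 0; rewrite /= ?mulmx0 enorm0.
(* By convention [sup] is 0 on a set without a supremum. *)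
have [hs|hs] := pselect (has_sup S); last by rewrite sup_out.
exact: ub_le_sup hs.2 _ S0.
Qed.

End EuclideanNorm.

(** * Jacobians, gradients and first-order Taylor estimates *)

Section Calculus.
Variables (R : realType) (n : nat).
Implicit Types x s : 'cV[R]_n.

Lemma cV_sum_delta (v : 'cV[R]_n) :
  v = \sum_(j < n) v j ord0 *: (delta_mx j ord0 : 'cV[R]_n).
Proof.
by rewrite [LHS]matrix_sum_delta; apply: eq_bigr => j _; rewrite big_ord1.
Qed.

Lemma jacE q (G : 'cV[R]_n -> 'cV[R]_q) x v : differentiable G x ->
  'd G x v = jac G x *m v.
Proof.
move=> dG; rewrite {1}(cV_sum_delta v) linear_sum.
apply/colP => i; rewrite summxE mxE; apply: eq_bigr => k _.
by rewrite linearZ !mxE mulrC.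
Qed.

Lemma gradE (g : 'cV[R]_n -> R) x v : differentiable g x ->
  'd g x v = dotv (grad g x) v.
Proof.
move=> dg; rewrite {1}(cV_sum_delta v) linear_sum.
by apply: eq_bigr => k _; rewrite linearZ !mxE mulrC.
Qed.

(** The mean value theorem on the segment from x to x + s replaces the increment by the gradient at
    an intermediate point, which is within L|s| of the gradient at x. *)
Lemma descent_lemma (g : 'cV[R]_n -> R) L x s :
  (forall x, differentiable g x) ->
  (forall u v, enorm (grad g u - grad g v) <= L * enorm (u - v)) ->
  `|g (x + s) - g x - dotv (grad g x) s| <= `|L| * enorm s ^+ 2.
Proof.
move=> dg lipg.
pose h (t : R) := g (x + t *: s).
have dh t : is_derive t (1 : R) h (dotv (grad g (x + t *: s)) s).
  pose l : R -> 'cV[R]_n := cst x + *:%R^~ s.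
  have dl : is_diff t l ( *:%R^~ s).
    by apply: is_diff_eq; rewrite add0r.
  have dhl : differentiable (g \o l) t.
    by apply: differentiable_comp (dg _); case: dl.
  apply: DeriveDef; first exact/derivable1_diffP.
  rewrite deriveE// -[h]/(g \o l) diff_comp; [|by case: dl|exact: dg].
  by case: dl => _ /= ->; rewrite scale1r gradE.
have [] := @MVT R h (fun t => dotv (grad g (x + t *: s)) s) 0 1 ltr01.
  apply: continuous_subspaceT => t; apply: differentiable_continuous.
  exact/derivable1_diffP/ex_derive.
move=> t; rewrite in_itv /= => /andP[t0 t1].
rewrite /h scale1r scale0r addr0 subr0 mulr1 => ->.
rewrite -dotvBl; apply: le_trans (normr_dotv_le _ _) _.
rewrite expr2 mulrA ler_wpM2r ?enorm_ge0//.
apply: le_trans (lipg _ _) _.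
rewrite addrAC subrr add0r enormZ (ger0_norm (ltW t0)).
apply: le_trans (ler_norm _) _; rewrite normrM ler_wpM2l//.
by rewrite normrM !ger0_norm ?enorm_ge0 ?(ltW t0)// ler_piMl ?enorm_ge0 ?ltW.
Qed.

Lemma diff_coord q (G : 'cV[R]_n -> 'cV[R]_q) x i : differentiable G x ->
  is_diff x (fun z => G z i ord0) (fun v => (jac G x *m v) i ord0).
Proof.
move=> dG.
(* Evaluation at a coordinate is packed as a linear map, so that it is its own differential and the
   chain rule applies. *)
pose f := fun N : 'cV[R]_q => N i ord0.
have linf : linear f by move=> a u v; rewrite /f !mxE.
pose HL := GRing.isLinear.Build _ _ _ _ f linf.
pose fL : {linear 'cV[R]_q -> R} := HB.pack f HL.
have cf : continuous fL by exact: coord_continuous.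
have df : differentiable fL (G x) by exact: linear_differentiable.
apply: DiffDef; first exact: (differentiable_comp dG df).
have -> : (fun z => G z i ord0) = fL \o G by [].
rewrite diff_comp// (diff_lin _ cf).
by apply/funext => v /=; rewrite jacE.
Qed.

Lemma grad_coord q (G : 'cV[R]_n -> 'cV[R]_q) x s i : differentiable G x ->
  dotv (grad (fun z => G z i ord0) x) s = (jac G x *m s) i ord0.
Proof.
move=> dG; have dGi := diff_coord i dG.
by case: dGi => ? dv; rewrite -gradE// dv.
Qed.

(** A sum of functions rather than of values, so that differentials can be taken term by term. *)
Lemma half_sq_sum q (G : 'cV[R]_n -> 'cV[R]_q) :
  half_sq G = \sum_(i < q) (2^-1 *: (fun z => G z i ord0 ^+ 2)).
Proof.
apply/funext => z; rewrite /half_sq enorm_sqr mulr_sumr fct_sumE.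
by apply: eq_bigr => i _; rewrite -expr2.
Qed.

Lemma diff_half_sq q (G : 'cV[R]_n -> 'cV[R]_q) x : differentiable G x ->
  is_diff x (half_sq G) (fun v => dotv (G x) (jac G x *m v)).
Proof.
move=> dG; rewrite half_sq_sum.
have di i := diff_coord i dG.
have dsq i : is_diff x (2^-1 *: (fun z => G z i ord0 ^+ 2))
    (fun v => G x i ord0 * (jac G x *m v) i ord0).
  apply: is_diff_eq; apply/funext => v /=.
  set a := (jac G x *m v) i ord0; set b := G x i ord0.
  by rewrite -[LHS]/(2^-1 * (b * a + b * a)); field.
have -> : (fun v => dotv (G x) (jac G x *m v)) =
    \sum_(i < q) (fun v => G x i ord0 * (jac G x *m v) i ord0).
  by apply/funext => v; rewrite fct_sumE.
elim/big_ind2 : _ => // [|f df g dg hf hg]; first exact: is_diff_cst.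
exact: is_diffD.
Qed.

Lemma grad_half_sq q (G : 'cV[R]_n -> 'cV[R]_q) x s : differentiable G x ->
  dotv (grad (half_sq G) x) s = dotv (G x) (jac G x *m s).
Proof. by move=> /diff_half_sq[? dv]; rewrite -gradE// dv. Qed.

(** Stated for matrix values so as to serve both the maps and their Jacobians. *)
Lemma compact_entry_bound q k (G : 'cV[R]_n -> 'M[R]_(q, k))
    (A : set 'cV[R]_n) : compact A -> continuous G ->
  exists2 K, 0 <= K & forall x, A x -> forall i j, `|G x i j| <= K.
Proof.
move=> cA cG.
have /compact_bounded/pinfty_ex_gt0[K K0 hK] : compact (G @` A).
  exact/continuous_compact/cA/continuous_subspaceT.
exists K => [|x Ax i j]; first exact: ltW.
have /le_trans : `|G x i j| <= `|G x|; last first.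
  by apply; apply: hK; exists x.
rewrite [X in _ <= X]/Num.norm /= mx_normrE; apply: le_trans (le_bigmax _ _ (i, j)).
by [].
Qed.

(** The descent lemma in each coordinate, since the Lipschitz assumption on [C] is made per
    component. *)
Lemma linearization_error q (G : 'cV[R]_n -> 'cV[R]_q) :
  (forall x, differentiable G x) ->
  (forall i : 'I_q, lipschitz_field (grad (fun x => G x i ord0))) ->
  exists2 K, 0 <= K & forall x s,
    enorm (G (x + s) - (G x + jac G x *m s)) <= K * enorm s ^+ 2.
Proof.
move=> dG /choice[L hL].
exists (q%:R * \sum_i `|L i|).
  by rewrite mulr_ge0// sumr_ge0.
move=> x s; rewrite -mulrA; apply: enorm_le_coord => i.
have dGi y : differentiable (fun z => G z i ord0) y by case: (diff_coord i (dG y)).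
have := descent_lemma x s dGi (hL i); rewrite grad_coord// !mxE opprD addrA.
move=> /le_trans; apply; rewrite ler_wpM2r ?sqr_ge0//.
by rewrite (bigD1 i)//= lerDl sumr_ge0.
Qed.

End Calculus.

(** * One-sided O-bounds with a constant uniform over a family *)

Definition dominated (R : realType) (T : Type) (P : T -> Prop) (X Y : T -> R) :=
  exists2 K : R, 0 <= K & forall t, P t -> X t <= K * Y t.

Section Dominated.
Variables (R : realType) (T : Type) (P : T -> Prop).
Implicit Types X Y Z : T -> R.
Local Notation dom := (dominated P).

Lemma dom_le X Y : (forall t, P t -> X t <= Y t) -> dom X Y.
Proof. by move=> h; exists 1 => // t /h; rewrite mul1r. Qed.

Lemma dom_trans Y X Z : dom X Y -> dom Y Z -> dom X Z.
Proof.
move=> [K K0 hK] [L L0 hL]; exists (K * L) => [|t Pt]; first exact: mulr_ge0.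
by apply: le_trans (hK t Pt) _; rewrite -mulrA ler_wpM2l// hL.
Qed.

Lemma dom_add X Y Z : dom X Z -> dom Y Z -> dom (fun t => X t + Y t) Z.
Proof.
move=> [K K0 hK] [L L0 hL]; exists (K + L) => [|t Pt]; first exact: addr_ge0.
by rewrite mulrDl lerD ?hK ?hL.
Qed.

Lemma dom_mul X Y X' Y' :
  (forall t, P t -> 0 <= X t) -> (forall t, P t -> 0 <= Y t) ->
  dom X X' -> dom Y Y' -> dom (fun t => X t * Y t) (fun t => X' t * Y' t).
Proof.
move=> X0 Y0 [K K0 hK] [L L0 hL]; exists (K * L) => [|t Pt].
  exact: mulr_ge0.
by rewrite mulrACA ler_pM ?hK ?hL ?X0 ?Y0.
Qed.

Lemma dom_scale k X Y : 0 <= k -> dom X Y -> dom (fun t => k * X t) Y.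
Proof.
move=> k0 [K K0 hK]; exists (k * K) => [|t Pt]; first exact: mulr_ge0.
by rewrite -mulrA ler_wpM2l// hK.
Qed.

Lemma dom_refl X : dom X X.
Proof. exact: dom_le. Qed.

Lemma dom_eq X' X Y : (forall t, P t -> X t <= X' t) -> dom X' Y -> dom X Y.
Proof. by move=> h; apply: dom_trans; apply: dom_le. Qed.

Lemma dom_wide Y' X Y : (forall t, P t -> Y' t <= Y t) -> dom X Y' -> dom X Y.
Proof. by move=> h /dom_trans; apply; apply: dom_le. Qed.

(** Since [Y] is nonnegative the constant may be enlarged, so finitely many dominations can share
    one constant taken near infinity. *)
Lemma dom_near X Y : (forall t, P t -> 0 <= Y t) -> dom X Y ->
  \forall K \near +oo, forall t, P t -> X t <= K * Y t.
Proof.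
move=> Y0 [K K0 hK]; near=> L => t Pt; apply: le_trans (hK t Pt) _.
by rewrite ler_wpM2r ?Y0//; near: L; exact: nbhs_pinfty_ge.
Unshelve. all: by end_near. Qed.

End Dominated.

(** Interface between the estimates on single trials and the analysis of the whole run; one constant
    [K] serves every field. The three bounds on values at the trial point are one-sided: only an
    actual reduction that falls short of the prediction does harm. *)
Record trial_bounds (R : realType) (d m p : nat)
    (F : 'cV[R]_d -> 'cV[R]_m) (C : 'cV[R]_d -> 'cV[R]_p)
    (r : run R d p) (K : R) (j i : nat) : Prop := TrialBounds {
  gamV_bound : (gam r j i)^-1 <= K;
  C_bound : enorm (C (x_ r j)) <= K;
  pred_c_lower : enorm (C (x_ r j)) ^+ 2 / gam r j i <= K * pred_c C r j i;
  pred_c_upper : pred_c C r j i <= K * (enorm (C (x_ r j)) ^+ 2 / gam r j i);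
  pred_t_lower : enorm (ghat F C r j i) ^+ 2 / gam r j i <= K * pred_t F C r j i;
  pred_t_upper : pred_t F C r j i <= K / gam r j i;
  ghat_dist : enorm (ghat F C r j i - W_ r j *m gradL F C r j)
    <= K * (enorm (C (x_ r j)) + (gam r j i)^-1);
  pred_l_dist : `|pred_l F C r j i - pred_t F C r j i|
    <= K * (enorm (C (x_ r j)) / gam r j i);
  C_next_bound : enorm (C (x_ r j + step r j i)) ^+ 2
      - (enorm (C (x_ r j)) ^+ 2 - 2 * pred_c C r j i)
    <= K * (enorm (C (x_ r j)) / gam r j i ^+ 2 + gam r j i ^- 2 ^+ 2);
  f_next_bound :
    pred_t F C r j i - (half_sq F (x_ r j) - half_sq F (x_ r j + step r j i))
    <= K * (enorm (C (x_ r j)) / gam r j i + (gam r j i)^-2);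
  lagrangian_next_bound :
    pred_t F C r j i - (lagrangian F C (x_ r j) (y_ r j)
      - lagrangian F C (x_ r j + step r j i) (y_ r j))
    <= K * (enorm (C (x_ r j)) / gam r j i + (gam r j i)^-2)
}.

(** * Estimates uniform over all trials, rejected ones included *)

Section TrialEstimates.
Variables (R : realType) (d m p : nat).
Variables (F : 'cV[R]_d -> 'cV[R]_m) (C : 'cV[R]_d -> 'cV[R]_p).
Variables (c : constants R) (r : run R d p).
Hypothesis cP : valid_constants m c.
Hypothesis rP : lm_run F C c r.
Hypothesis A1 : assumption_A1 r.
Hypothesis A2 : assumption_A2 F C.
Hypothesis A3 : assumption_A3 C r.
Hypothesis A4 : assumption_A4 r.

Definition trial (t : nat * nat) : Prop := (t.2 <= rej r t.1)%N.

Local Notation dom := (dominated trial).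
Local Notation g t := (gam r t.1 t.2).
Local Notation cn t := (enorm (C (x_ r t.1))).
Local Notation xx t := (x_ r t.1).
Local Notation ss t := (step r t.1 t.2).
Local Notation nn t := (n_ r t.1 t.2).
Local Notation tg t := (t_ r t.1 t.2).
Local Notation tt t := (tt_ r t.1 t.2).
Local Notation gr t := (gradL F C r t.1).
Local Notation gh t := (ghat F C r t.1 t.2).
Local Notation gv t := (gvec F C r t.1 t.2).

(** Rejections multiply gamma by [ghat2 > 1] and an acceptance leaves at least [gmin], so only
    iteration 0 can see values below [gmin], and these stay above the initial one. *)
Lemma gam_lower : exists2 g0, 0 < g0 & forall t, trial t -> g0 <= g t.
Proof.
have [g00 _ step_r] := rP; have [_ [_ gh2 gm0] _ _ _] := cP.
exists (Num.min (gam r 0%N 0%N) (gmin c)); first by rewrite lt_min g00.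
move=> [j i]; rewrite /trial /=; elim: j i => [|j IH].
  elim=> [_|i IHi ij]; first by rewrite ge_min lexx.
  have [_ _ _ hrej _] := step_r 0%N; have [_ ->] := hrej _ ij.
  apply: le_trans (IHi (ltnW ij)) _; rewrite ler_peMl ?ltW//.
  by apply: lt_le_trans (IHi (ltnW ij)); rewrite lt_min g00.
elim=> [_|i IHi ij].
  have [_ _ _ _ [_ [_ -> _]]] := step_r j.
  by rewrite ge_min !le_max lexx orbT.
have [_ _ _ hrej _] := step_r j.+1; have [_ ->] := hrej _ ij.
apply: le_trans (IHi (ltnW ij)) _; rewrite ler_peMl ?ltW//.
by apply: lt_le_trans (IHi (ltnW ij)); rewrite lt_min g00.
Qed.

Lemma gam_gt0 t : trial t -> 0 < g t.
Proof. by have [g0 g0P h] := gam_lower => /h; apply: lt_le_trans. Qed.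

Lemma dom_gamV : dom (fun t => (g t)^-1) (fun=> 1).
Proof.
have [g0 g0P h] := gam_lower; exists g0^-1; first by rewrite invr_ge0 ltW.
by move=> t tP; rewrite mulr1 lef_pV2 ?h// posrE gam_gt0.
Qed.

Lemma entry_bounded q k (G : 'cV[R]_d -> 'M[R]_(q, k)) : continuous G ->
  exists2 K, 0 <= K & forall j a b, `|G (x_ r j) a b| <= K.
Proof.
move=> cG; have [Om [cO hO]] := A1.
have [K K0 hK] := compact_entry_bound cO cG.
by exists K => // j; apply: hK; have [] := hO j.
Qed.

Lemma enorm_bounded q (G : 'cV[R]_d -> 'cV[R]_q) : (forall x, differentiable G x) ->
  dom (fun t => enorm (G (xx t))) (fun=> 1).
Proof.
move=> dG; have cG : continuous G by move=> x; exact: differentiable_continuous.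
have [K K0 hK] := entry_bounded cG.
exists (q%:R * K) => [|t _]; first exact: mulr_ge0.
by rewrite mulr1; apply: enorm_le_coord => i; exact: hK.
Qed.

Lemma dF x : differentiable F x. Proof. by have [[]] := A2. Qed.
Lemma dC x : differentiable C x. Proof. by have [_ []] := A2. Qed.

Lemma dom_C : dom (fun t => cn t) (fun=> 1).
Proof. exact/enorm_bounded/dC. Qed.

Lemma mulmx_bounded q (G : 'cV[R]_d -> 'cV[R]_q) : continuous (jac G) ->
  exists2 K, 0 <= K & forall j,
    (forall v, enorm (jac G (x_ r j) *m v) <= K * enorm v) /\
    (forall v, enorm ((jac G (x_ r j))^T *m v) <= K * enorm v).
Proof.
move=> /entry_bounded[K K0 hK].
exists (q%:R * (d%:R * K)) => [|j]; first by rewrite !mulr_ge0.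
split=> v; first exact: enorm_mulmx_le.
by rewrite mulrCA; apply: enorm_mulmx_le => a b; rewrite mxE.
Qed.

Lemma Jc_bounded : exists2 K, 0 <= K & forall j,
    (forall v, enorm (Jc C r j *m v) <= K * enorm v) /\
    (forall v, enorm ((Jc C r j)^T *m v) <= K * enorm v).
Proof. by apply: mulmx_bounded; have [_ []] := A2. Qed.

Lemma JF_bounded : exists2 K, 0 <= K & forall j,
    (forall v, enorm (JF F r j *m v) <= K * enorm v) /\
    (forall v, enorm ((JF F r j)^T *m v) <= K * enorm v).
Proof. by apply: mulmx_bounded; have [[]] := A2. Qed.

(** * The quasi-normal step and the predicted constraint reduction *)

Lemma pred_cE t : pred_c C r t.1 t.2 =
  - dotv (C (xx t)) (Jc C r t.1 *m nn t)
  - 2^-1 * enorm (Jc C r t.1 *m nn t) ^+ 2 - 2^-1 * g t * enorm (nn t) ^+ 2.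
Proof.
rewrite /pred_c /model_c /half_sq !enorm_sqr dotvDl !dotvDr.
rewrite (dotvC (Jc C r t.1 *m nn t)); lra.
Qed.

Lemma cond_N_pred_c t : trial t ->
  kappa1 c * cn t ^+ 2 / (opnorm (Jc C r t.1) ^+ 2 + g t) <= pred_c C r t.1 t.2.
Proof.
have [_ _ /(_ t.1)[_ _ + _ _] tP] := rP; move=> /(_ t.2 tP)[].
by rewrite /cond_N {1}/model_c mulmx0 addr0 enorm0 expr0n /= mulr0 addr0.
Qed.

Lemma opnorm_gam_gt0 q (A : 'M[R]_(q, d)) t : trial t ->
  0 < opnorm A ^+ 2 + g t.
Proof. by move=> tP; rewrite ltr_wpDl ?sqr_ge0 ?gam_gt0. Qed.

(** As gamma stays above some [g0], a bounded [opnorm ^+ 2] is absorbed by a multiple of gamma. The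
    denominators of (N) and (T) thus count as gamma. *)
Lemma dom_opnorm q (G : nat -> 'M[R]_(q, d)) K : 0 <= K ->
    (forall j v, enorm (G j *m v) <= K * enorm v) ->
  dom (fun t => opnorm (G t.1) ^+ 2 + g t) (fun t => g t).
Proof.
move=> K0 hK; have [g0 g0P hg] := gam_lower.
exists (K ^+ 2 / g0 + 1) => [|t tP].
  by rewrite addr_ge0// divr_ge0 ?sqr_ge0 ?ltW.
rewrite mulrDl mul1r lerD2r mulrAC ler_pdivlMr//.
rewrite ler_pM ?sqr_ge0 ?hg ?(ltW g0P)//.
rewrite ler_pXn2r ?nnegrE ?opnorm_ge0//.
by apply: le_trans (opnorm_le (hK _)) _; rewrite ger0_norm.
Qed.

Lemma pred_c_ge0 t : trial t -> 0 <= pred_c C r t.1 t.2.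
Proof.
move=> tP; apply: le_trans (cond_N_pred_c tP).
have [_ _ _ [k1 _ _ _ _] _] := cP.
by rewrite divr_ge0 ?(ltW (opnorm_gam_gt0 _ tP))// mulr_ge0 ?sqr_ge0 ?ltW.
Qed.

Lemma dom_pred_c_lower :
  dom (fun t => cn t ^+ 2 / g t) (fun t => pred_c C r t.1 t.2).
Proof.
have [_ _ _ [k1 _ _ _ _] _] := cP.
have [KJ KJ0 hJ] := Jc_bounded.
have [K K0 hK] := dom_opnorm KJ0 (fun j => (hJ j).1).
exists (K / kappa1 c) => [|t tP]; first by rewrite divr_ge0// ltW.
have gP := gam_gt0 tP; have oP := opnorm_gam_gt0 (Jc C r t.1) tP.
apply: le_trans (_ : _ <= K / kappa1 c *
  (kappa1 c * cn t ^+ 2 / (opnorm (Jc C r t.1) ^+ 2 + g t))) _; last first.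
  by rewrite ler_wpM2l ?cond_N_pred_c// divr_ge0// ltW.
have -> : K / kappa1 c * (kappa1 c * cn t ^+ 2 / (opnorm (Jc C r t.1) ^+ 2 + g t))
    = cn t ^+ 2 * (K / (opnorm (Jc C r t.1) ^+ 2 + g t)).
  by field; rewrite !gt_eqF.
rewrite ler_wpM2l ?sqr_ge0// ler_pdivlMr// mulrC ler_pdivrMr//.
exact: hK.
Qed.

Lemma pred_c_le t : trial t -> pred_c C r t.1 t.2 <= 2^-1 * cn t ^+ 2.
Proof.
move=> tP; rewrite /pred_c /half_sq /model_c gerBl.
by rewrite addr_ge0 ?mulr_ge0 ?invr_ge0 ?mulr_ge0 ?invr_ge0 ?enorm_ge0 ?(ltW (gam_gt0 tP)).
Qed.

Lemma sqr_linearized_le t : trial t ->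
  enorm (C (xx t) + Jc C r t.1 *m nn t) ^+ 2 <= cn t ^+ 2 - 2 * pred_c C r t.1 t.2.
Proof.
move=> tP; rewrite /pred_c /half_sq /model_c.
have : 0 <= g t * enorm (nn t) ^+ 2.
  by rewrite mulr_ge0 ?sqr_ge0 ?ltW ?gam_gt0.
lra.
Qed.

(** Used for [n_] and [tt_], in both cases with a quadratic regularization term bounded by a linear
    one. *)
Lemma le_div_of_sqr (a b gm : R) : 0 <= a -> 0 <= b -> 0 < gm ->
  gm * a ^+ 2 <= b * a -> a <= b / gm.
Proof.
move=> a0 b0 gP; rewrite ler_pdivlMr//.
move: a0; rewrite le_eqVlt => /orP[/eqP<- _|aP]; first by rewrite mul0r.
by rewrite expr2 mulrA ler_pM2r// mulrC.
Qed.

(** Dropping the nonnegative |Jc n|^2 in [pred_cE] leaves one inequality with two uses: together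
    with [pred_c >= 0] it bounds [n_], and that bound then gives the upper bound on [pred_c]. *)
Lemma pred_c_upper_aux : exists2 K, 0 <= K & forall t, trial t ->
  pred_c C r t.1 t.2 + 2^-1 * g t * enorm (nn t) ^+ 2 <= K * cn t * enorm (nn t).
Proof.
have [K K0 hJ] := Jc_bounded; exists K => // t tP.
rewrite pred_cE.
have h1 := normr_dotv_le (C (xx t)) (Jc C r t.1 *m nn t).
have h2 : cn t * enorm (Jc C r t.1 *m nn t) <= cn t * (K * enorm (nn t)).
  by rewrite ler_wpM2l ?enorm_ge0//; have [] := hJ t.1.
have := sqr_ge0 (enorm (Jc C r t.1 *m nn t)).
move: h1; rewrite ler_norml => /andP[h1 _]; lra.
Qed.

Lemma dom_n : dom (fun t => enorm (nn t)) (fun t => cn t / g t).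
Proof.
have [K K0 hK] := pred_c_upper_aux; exists (2 * K) => [|t tP].
  by rewrite mulr_ge0.
rewrite mulrA; apply: le_div_of_sqr; rewrite ?enorm_ge0 ?gam_gt0//.
  by rewrite !mulr_ge0 ?enorm_ge0.
have := hK t tP; have := pred_c_ge0 tP; lra.
Qed.

Lemma dom_pred_c : dom (fun t => pred_c C r t.1 t.2) (fun t => cn t ^+ 2 / g t).
Proof.
have [K K0 hK] := pred_c_upper_aux.
apply: (@dom_eq _ _ _ (fun t => K * (cn t * enorm (nn t)))) => [t tP|].
  apply: le_trans (_ : _ <= pred_c C r t.1 t.2 + 2^-1 * g t * enorm (nn t) ^+ 2) _.
    by rewrite lerDl ?mulr_ge0 ?invr_ge0 ?mulr_ge0 ?invr_ge0 ?enorm_ge0 ?(ltW (gam_gt0 tP)).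
  by have := hK t tP; rewrite -(mulrA K).
apply: dom_scale => //.
apply: (@dom_wide _ _ _ (fun t => cn t * (cn t / g t))) => [t _|].
  by rewrite expr2 mulrA.
by apply: dom_mul dom_n => // *; rewrite ?enorm_ge0//; apply: dom_refl.
Qed.

Lemma trialP t : trial t -> valid_trial F C c r t.1 t.2.
Proof. by move=> tP; have [_ _ /(_ t.1)[_ _ + _ _]] := rP; exact. Qed.

Lemma projP j : null_projector (Jc C r j) (W_ r j).
Proof. by have [_ _ /(_ j)[]] := rP. Qed.

Lemma enorm_W j v : enorm (W_ r j *m v) <= enorm v.
Proof. by have [? ? _] := projP j; exact: enorm_projector. Qed.

Lemma Jc_W j (v : 'cV[R]_d) : Jc C r j *m (W_ r j *m v) = 0.
Proof. by have [_ WW kW] := projP j; apply/kW; rewrite mulmxA WW. Qed.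

Lemma dom_C_gamV : dom (fun t => cn t / g t) (fun t => cn t).
Proof.
apply: (@dom_wide _ _ _ (fun t => cn t * 1)) => [t _|]; first by rewrite mulr1.
apply: dom_mul (dom_gamV) => [t _|t tP|]; rewrite ?enorm_ge0//.
  by rewrite invr_ge0 ltW ?gam_gt0.
exact: dom_refl.
Qed.

(** The regularization part gamma n is O(|C|) because n = O(|C|/gamma); the Gauss-Newton part is no
    larger, gamma being bounded below. *)
Lemma dom_H_n : dom (fun t => enorm (Hmat F r t.1 t.2 *m nn t)) (fun t => cn t).
Proof.
have [K K0 hJ] := JF_bounded.
apply: (@dom_eq _ _ _ (fun t => K * K * enorm (nn t) + g t * enorm (nn t))).
  move=> t tP; rewrite /Hmat mulmxDl; apply: le_trans (ler_enormD _ _) _.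
  rewrite mul_scalar_mx enormZ gtr0_norm ?gam_gt0// lerD2r -mulmxA -mulrA.
  have [h1 h2] := hJ t.1; apply: le_trans (h2 _) _.
  by rewrite ler_wpM2l.
apply: dom_add.
  apply: dom_scale (mulr_ge0 K0 K0) _; exact: dom_trans dom_n dom_C_gamV.
have [L L0 hL] := dom_n; exists L => // t tP.
by have := hL t tP; rewrite mulrA ler_pdivlMr ?gam_gt0// mulrC.
Qed.

Lemma dom_gradL : dom (fun t => enorm (gr t)) (fun=> 1).
Proof.
have [K K0 hJ] := JF_bounded; have [L L0 hJc] := Jc_bounded.
have [ky [ky0 hy]] := A4; have [B B0 hF] := enorm_bounded dF.
exists (K * B + L * ky) => [|t tP].
  by rewrite addr_ge0// mulr_ge0// ltW.
rewrite mulr1; apply: le_trans (ler_enormD _ _) _; rewrite lerD//.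
  apply: le_trans ((hJ _).2 _) _; rewrite ler_wpM2l//.
  by have := hF t tP; rewrite mulr1.
by apply: le_trans ((hJc _).2 _) _; rewrite ler_wpM2l.
Qed.

Lemma dom_gvec : dom (fun t => enorm (gv t)) (fun=> 1).
Proof.
apply: (@dom_eq _ _ _ (fun t => enorm (gr t) + enorm (Hmat F r t.1 t.2 *m nn t))).
  by move=> t _; exact: ler_enormD.
exact: dom_add dom_gradL (dom_trans dom_H_n dom_C).
Qed.

Lemma Wt_bounded : exists2 K, 0 <= K & forall t, trial t ->
  forall v, enorm (Wt r t.1 t.2 v) <= K * enorm v.
Proof.
have [kJ [kW [_ kW0 h]]] := A3; exists kW => [|t tP v]; first exact: ltW.
by have [_ _] := h t.1; apply.
Qed.

Lemma dom_ghat : dom (fun t => enorm (gh t)) (fun=> 1).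
Proof.
have [K K0 hK] := Wt_bounded.
apply: dom_trans dom_gvec; exists K => // t tP; exact: hK.
Qed.

(** The vector [W_ *m gradL] does not change with the trial, so it is a common reference for the
    [ghat] of all trials of one iteration. The distance to it comes from (W), of order 1/gamma, and
    from W H n, of order |C|. *)
Lemma dom_ghat_dist : dom (fun t => enorm (gh t - W_ r t.1 *m gr t))
  (fun t => cn t + (g t)^-1).
Proof.
apply: (@dom_eq _ _ _ (fun t =>
    xi1 c / g t + enorm (Hmat F r t.1 t.2 *m nn t))) => [t tP|].
  have -> : gh t - W_ r t.1 *m gr t = (gh t - W_ r t.1 *m gv t)
      + W_ r t.1 *m (Hmat F r t.1 t.2 *m nn t).
    by rewrite /gvec (mulmxDr _ (gr t)) opprD addrA subrK.
  apply: le_trans (ler_enormD _ _) _; rewrite lerD ?enorm_W//.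
  by have [_ [_ ]] := trialP tP.
apply: dom_add.
  have [_ _ _ [_ _ _ xi10 _] _] := cP.
  apply: dom_scale (ltW xi10) _; apply: dom_le => t tP.
  by rewrite lerDr enorm_ge0.
apply: dom_trans dom_H_n _; apply: dom_le => t tP.
by rewrite lerDl invr_ge0 ltW ?gam_gt0.
Qed.

(** * The tangential step and the constraint value at the trial point *)

Lemma pred_t_ge t : trial t ->
  kappa2 c * enorm (gh t) ^+ 2 / (opnorm (JF F r t.1) ^+ 2 + g t)
    <= pred_t F C r t.1 t.2.
Proof. by move=> /trialP[_ _ []]. Qed.

Lemma pred_t_ge0 t : trial t -> 0 <= pred_t F C r t.1 t.2.
Proof.
move=> tP; apply: le_trans (pred_t_ge tP).
have [_ _ _ [_ k2 _ _ _] _] := cP.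
by rewrite divr_ge0 ?(ltW (opnorm_gam_gt0 _ tP))// mulr_ge0 ?sqr_ge0 ?ltW.
Qed.

Lemma dom_pred_t_lower :
  dom (fun t => enorm (gh t) ^+ 2 / g t) (fun t => pred_t F C r t.1 t.2).
Proof.
have [_ _ _ [_ k2 _ _ _] _] := cP.
have [KJ KJ0 hJ] := JF_bounded.
have [K K0 hK] := dom_opnorm KJ0 (fun j => (hJ j).1).
exists (K / kappa2 c) => [|t tP]; first by rewrite divr_ge0// ltW.
have gP := gam_gt0 tP; have oP := opnorm_gam_gt0 (JF F r t.1) tP.
apply: le_trans (_ : _ <= K / kappa2 c *
  (kappa2 c * enorm (gh t) ^+ 2 / (opnorm (JF F r t.1) ^+ 2 + g t))) _; last first.
  by rewrite ler_wpM2l ?pred_t_ge// divr_ge0// ltW.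
have -> : K / kappa2 c * (kappa2 c * enorm (gh t) ^+ 2 / (opnorm (JF F r t.1) ^+ 2 + g t))
    = enorm (gh t) ^+ 2 * (K / (opnorm (JF F r t.1) ^+ 2 + g t)).
  by field; rewrite !gt_eqF.
rewrite ler_wpM2l ?sqr_ge0// ler_pdivlMr// mulrC ler_pdivrMr//.
exact: hK.
Qed.

Lemma dotv_H t v : dotv (Hmat F r t.1 t.2 *m v) v =
  enorm (JF F r t.1 *m v) ^+ 2 + g t * enorm v ^+ 2.
Proof.
by rewrite /Hmat mulmxDl dotvDl mul_scalar_mx dotvZl -mulmxA !enorm_sqr
  dotv_mull trmxK.
Qed.

Lemma pred_t_le t : trial t -> pred_t F C r t.1 t.2 <= - dotv (gh t) (tt t).
Proof.
move=> tP; rewrite /pred_t gerDr oppr_le0 dotv_H.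
by rewrite mulr_ge0 ?invr_ge0// addr_ge0 ?sqr_ge0// mulr_ge0 ?sqr_ge0 ?ltW ?gam_gt0.
Qed.

(** From [pred_t >= 0] and H >= gamma I follows gamma |tt|^2 <= 2 |ghat| |tt|, where [ghat] is
    bounded. *)
Lemma dom_tt : dom (fun t => enorm (tt t)) (fun t => (g t)^-1).
Proof.
have [K K0 hK] := dom_ghat; exists (2 * K) => [|t tP]; first by rewrite mulr_ge0.
apply: le_div_of_sqr; rewrite ?enorm_ge0 ?gam_gt0 ?mulr_ge0//.
have := pred_t_ge0 tP; rewrite /pred_t dotv_H.
have := normr_dotv_le (gh t) (tt t); rewrite ler_norml => /andP[h1 _].
have := sqr_ge0 (enorm (JF F r t.1 *m tt t)).
have h2 : enorm (gh t) * enorm (tt t) <= K * enorm (tt t).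
  by rewrite ler_wpM2r ?enorm_ge0//; have := hK t tP; rewrite mulr1.
lra.
Qed.

Lemma dom_pred_t : dom (fun t => pred_t F C r t.1 t.2) (fun t => (g t)^-1).
Proof.
apply: (@dom_eq _ _ _ (fun t => enorm (gh t) * enorm (tt t))) => [t tP|].
  apply: le_trans (pred_t_le tP) _; rewrite -dotvNl -(enormN (gh t)).
  exact: dotv_le.
apply: (@dom_wide _ _ _ (fun t => 1 * (g t)^-1)) => [t _|]; first by rewrite mul1r.
by apply: dom_mul dom_ghat dom_tt => t _; exact: enorm_ge0.
Qed.

Lemma dom_t_dist : dom (fun t => enorm (tg t - W_ r t.1 *m tt t))
  (fun t => (g t)^-2).
Proof.
have [_ _ _ [_ _ _ _ xi20] _] := cP.
by exists (xi2 c) => [|t /trialP[]//]; exact: ltW.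
Qed.

Lemma dom_gamV2 : dom (fun t => (g t)^-2) (fun t => (g t)^-1).
Proof.
have [K K0 hK] := dom_gamV; exists K => // t tP.
have := hK t tP; rewrite mulr1 => h.
by rewrite expr2 invfM ler_wpM2r// invr_ge0 ltW ?gam_gt0.
Qed.

Lemma dom_t : dom (fun t => enorm (tg t)) (fun t => (g t)^-1).
Proof.
apply: (@dom_eq _ _ _ (fun t =>
  enorm (tg t - W_ r t.1 *m tt t) + enorm (tt t))) => [t tP|].
  rewrite -{1}(subrK (W_ r t.1 *m tt t) (tg t)).
  by apply: le_trans (ler_enormD _ _) _; rewrite lerD2l enorm_W.
exact: dom_add (dom_trans dom_t_dist dom_gamV2) dom_tt.
Qed.

Lemma dom_n_gamV : dom (fun t => enorm (nn t)) (fun t => (g t)^-1).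
Proof.
apply: dom_trans dom_n _.
apply: (@dom_wide _ _ _ (fun t => 1 * (g t)^-1)) => [t _|]; first by rewrite mul1r.
apply: dom_mul dom_C (dom_refl _ _) => t tP; first exact: enorm_ge0.
by rewrite invr_ge0 ltW ?gam_gt0.
Qed.

Lemma dom_step_sqr : dom (fun t => enorm (ss t) ^+ 2) (fun t => (g t)^-2).
Proof.
have hs : dom (fun t => enorm (ss t)) (fun t => (g t)^-1).
  apply: (@dom_eq _ _ _ (fun t => enorm (nn t) + enorm (tg t))) => [t _|].
    exact: ler_enormD.
  exact: dom_add dom_n_gamV dom_t.
apply: (@dom_wide _ _ _ (fun t => (g t)^-1 * (g t)^-1)) => [t _|].
  by rewrite expr2 invfM.
apply: (dom_mul _ _ hs hs) => t _; exact: enorm_ge0.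
Qed.

(** [Jc] annihilates the range of [W_], so only the error allowed by (P) survives: a tangential step
    of size 1/gamma moves the linearized constraint by O(1/gamma^2). *)
Lemma dom_Jc_t : dom (fun t => enorm (Jc C r t.1 *m tg t)) (fun t => (g t)^-2).
Proof.
have [K K0 hJ] := Jc_bounded.
apply: dom_trans dom_t_dist; exists K => // t _.
rewrite -[X in _ *m X](subrK (W_ r t.1 *m tt t)) mulmxDr Jc_W addr0.
exact: (hJ _).1.
Qed.

Lemma dom_linearization : dom
  (fun t => enorm (C (xx t + ss t) - (C (xx t) + Jc C r t.1 *m ss t)))
  (fun t => (g t)^-2).
Proof.
have [_ _ _ _ lipC] := A2; have [K K0 hK] := linearization_error dC lipC.
by apply: dom_trans dom_step_sqr; exists K => // t _; apply: hK.
Qed.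

Lemma gamV_ge0 t : trial t -> 0 <= (g t)^-1.
Proof. by move=> tP; rewrite invr_ge0 ltW ?gam_gt0. Qed.

Lemma gamV2_ge0 t : trial t -> 0 <= (g t)^-2.
Proof. by move=> tP; rewrite invr_ge0 sqr_ge0. Qed.

(** The new constraint value is the linearized one at [n_], whose square is at most |C|^2 - 2
    pred_c, plus a vector of size at most [e] = O(1/gamma^2) from [Jc *m t_] and the linearization.
    Squaring adds at most 2|C|e + e^2. *)
Lemma dom_C_next : dom
  (fun t => enorm (C (xx t + ss t)) ^+ 2 - (cn t ^+ 2 - 2 * pred_c C r t.1 t.2))
  (fun t => cn t / g t ^+ 2 + g t ^- 2 ^+ 2).
Proof.
pose e t := enorm (Jc C r t.1 *m tg t)
  + enorm (C (xx t + ss t) - (C (xx t) + Jc C r t.1 *m ss t)).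
have e0 t : 0 <= e t by rewrite addr_ge0 ?enorm_ge0.
have he : dom e (fun t => (g t)^-2) := dom_add dom_Jc_t dom_linearization.
apply: (@dom_eq _ _ _ (fun t => 2 * (cn t * e t) + e t * e t)) => [t tP|].
  set b := enorm (C (xx t) + Jc C r t.1 *m nn t).
  have hb : enorm (C (xx t + ss t)) <= b + e t.
    have -> : C (xx t + ss t) = (C (xx t) + Jc C r t.1 *m nn t)
      + (Jc C r t.1 *m tg t + (C (xx t + ss t) - (C (xx t) + Jc C r t.1 *m ss t))).
      have -> : Jc C r t.1 *m ss t = Jc C r t.1 *m nn t + Jc C r t.1 *m tg t.
        by rewrite -mulmxDr.
      move: (C (xx t + _)) (C (xx t)) (_ *m nn t) (_ *m tg t) => z w u v.
      by rewrite (addrA (w + u)) (addrA w u v) addrC subrK.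
    by apply: le_trans (ler_enormD _ _) _; rewrite lerD2l; apply: ler_enormD.
  have bc := sqr_linearized_le tP; rewrite -/b in bc.
  have b0 : 0 <= b := enorm_ge0 _.
  have bcn : b <= cn t.
    rewrite -(@ler_pXn2r _ 2) ?nnegrE ?enorm_ge0//.
    by have := pred_c_ge0 tP; lra.
  have h1 : enorm (C (xx t + ss t)) ^+ 2 <= (b + e t) ^+ 2.
    by rewrite ler_pXn2r ?nnegrE ?addr_ge0 ?enorm_ge0.
  have h2 : b * e t <= cn t * e t by rewrite ler_wpM2r.
  lra.
apply: dom_add.
  apply: dom_scale => //.
  apply: (@dom_wide _ _ _ (fun t => cn t * (g t)^-2)) => [t tP|].
    by rewrite lerDl sqr_ge0.
  by apply: (dom_mul _ _ (dom_refl _ _) he) => t _ //; exact: enorm_ge0.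
apply: (@dom_wide _ _ _ (fun t => (g t)^-2 * (g t)^-2)) => [t tP|].
  by rewrite -expr2 lerDr mulr_ge0 ?enorm_ge0 ?gamV2_ge0.
by apply: (dom_mul _ _ he he) => t _; exact: e0.
Qed.

(** * Gaps between predicted and actual reductions of f and the Lagrangian *)

Let E t : R := cn t / g t + (g t)^-2.

Lemma dom_E1 X : dom X (fun t => cn t / g t) -> dom X E.
Proof. by apply: dom_wide => t tP; rewrite lerDl gamV2_ge0. Qed.

Lemma dom_E2 X : dom X (fun t => (g t)^-2) -> dom X E.
Proof.
by apply: dom_wide => t tP; rewrite lerDr mulr_ge0 ?enorm_ge0 ?gamV_ge0.
Qed.

Lemma dom_dotv q (u v : nat * nat -> 'cV[R]_q) X Y :
  dom (fun t => enorm (u t)) X -> dom (fun t => enorm (v t)) Y ->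
  dom (fun t => `|dotv (u t) (v t)|) (fun t => X t * Y t).
Proof.
move=> hu hv; apply: (@dom_eq _ _ _ (fun t => enorm (u t) * enorm (v t))).
  by move=> t _; exact: normr_dotv_le.
by apply: dom_mul hu hv => t _; exact: enorm_ge0.
Qed.

Lemma dom_dotv1 q (u v : nat * nat -> 'cV[R]_q) Y :
  dom (fun t => enorm (u t)) (fun=> 1) -> dom (fun t => enorm (v t)) Y ->
  dom (fun t => `|dotv (u t) (v t)|) Y.
Proof.
move=> hu hv; apply: dom_wide (dom_dotv hu hv) => t _; by rewrite mul1r.
Qed.

(** Up to the error of (P), <gradL, t> is <gradL, W tt> = <W gradL, tt>, which is close to <ghat,
    tt> <= - pred_t. The normal part <gradL, n> is itself an error term. *)
Lemma dom_gradL_step :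
  dom (fun t => dotv (gr t) (ss t) + pred_t F C r t.1 t.2) E.
Proof.
apply: (@dom_eq _ _ _ (fun t => `|dotv (gr t) (nn t)|
  + `|dotv (gr t) (tg t - W_ r t.1 *m tt t)|
  + `|dotv (gh t - W_ r t.1 *m gr t) (tt t)|)) => [t tP|].
  have h := pred_t_le tP.
  have -> : dotv (gr t) (ss t) = dotv (gr t) (nn t)
      + dotv (gr t) (tg t - W_ r t.1 *m tt t)
      - dotv (gh t - W_ r t.1 *m gr t) (tt t) + dotv (gh t) (tt t).
    rewrite (dotvDr (nn t) (tg t)) dotvBr dotvBl dotv_mull.
    have [-> _ _] := projP t.1.
    lra.
  have h1 := ler_norm (dotv (gr t) (nn t)).
  have h2 := ler_norm (dotv (gr t) (tg t - W_ r t.1 *m tt t)).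
  have h3 := ler_norm (- dotv (gh t - W_ r t.1 *m gr t) (tt t)).
  rewrite normrN in h3; lra.
apply: dom_add; first apply: dom_add.
- exact/dom_E1/(dom_dotv1 dom_gradL dom_n).
- exact/dom_E2/(dom_dotv1 dom_gradL dom_t_dist).
apply: dom_wide (dom_dotv dom_ghat_dist dom_tt) => t tP.
by rewrite mulrDl /E -invfM expr2.
Qed.

Lemma dom_f_taylor : dom
  (fun t => half_sq F (xx t + ss t) - half_sq F (xx t)
    - dotv ((JF F r t.1)^T *m F (xx t)) (ss t)) (fun t => (g t)^-2).
Proof.
have [_ _ [L lipF] _ _] := A2.
apply: dom_trans dom_step_sqr; exists `|L| => // t _.
have df x : differentiable (half_sq F) x by case: (diff_half_sq (dF x)).
apply: le_trans (ler_norm _) _.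
have := descent_lemma (xx t) (ss t) df lipF; rewrite grad_half_sq; last exact: dF.
by rewrite dotv_mull trmxK.
Qed.

Lemma dom_yC_taylor : dom
  (fun t => `|dotv (y_ r t.1) (C (xx t + ss t)) - dotv (y_ r t.1) (C (xx t))
    - dotv ((Jc C r t.1)^T *m y_ r t.1) (ss t)|) (fun t => (g t)^-2).
Proof.
apply: (@dom_eq _ _ _ (fun t => `|dotv (y_ r t.1)
    (C (xx t + ss t) - (C (xx t) + Jc C r t.1 *m ss t))|)) => [t _|].
  rewrite [X in _ <= `|X|]dotvBr [in X in _ <= X]dotvDr dotv_mull trmxK.
  by rewrite opprD (addrA (dotv _ (C (_ + ss t)))).
apply: dom_dotv1 dom_linearization.
by have [ky [ky0 hy]] := A4; exists ky => [|t _]; rewrite ?mulr1 ?(ltW ky0).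
Qed.

(** The gradients of f and of the Lagrangian differ by Jc^T y. Its product with the step pairs y
    with Jc n and Jc t, of orders |C|/gamma and 1/gamma^2, so f has the same gap as the
    Lagrangian. *)
Lemma dom_f_next : dom
  (fun t => pred_t F C r t.1 t.2 - (half_sq F (xx t) - half_sq F (xx t + ss t))) E.
Proof.
apply: (@dom_eq _ _ _ (fun t =>
  (half_sq F (xx t + ss t) - half_sq F (xx t)
    - dotv ((JF F r t.1)^T *m F (xx t)) (ss t))
  + (dotv (gr t) (ss t) + pred_t F C r t.1 t.2)
  + (`|dotv (y_ r t.1) (Jc C r t.1 *m nn t)|
     + `|dotv (y_ r t.1) (Jc C r t.1 *m tg t)|))) => [t tP|].
  have h1 := ler_norm (- dotv (y_ r t.1) (Jc C r t.1 *m nn t)).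
  have h2 := ler_norm (- dotv (y_ r t.1) (Jc C r t.1 *m tg t)).
  rewrite !normrN in h1 h2.
  have -> : dotv (gr t) (ss t) = dotv ((JF F r t.1)^T *m F (xx t)) (ss t)
      + (dotv (y_ r t.1) (Jc C r t.1 *m nn t)
         + dotv (y_ r t.1) (Jc C r t.1 *m tg t)).
    rewrite -dotvDr -mulmxDr dotvDl; congr (_ + _).
    by rewrite dotv_mull trmxK.
  lra.
have hy : dom (fun t => enorm (y_ r t.1)) (fun=> 1).
  by have [ky [ky0 hy]] := A4; exists ky => [|t _]; rewrite ?mulr1 ?(ltW ky0).
apply: dom_add; first apply: dom_add.
- exact/dom_E2/dom_f_taylor.
- exact: dom_gradL_step.
apply: dom_add; last exact/dom_E2/(dom_dotv1 hy dom_Jc_t).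
apply/dom_E1/(dom_dotv1 hy)/dom_trans/dom_n.
by have [K K0 hJ] := Jc_bounded; exists K => // t _; exact: (hJ _).1.
Qed.

Lemma dom_lagrangian_next : dom
  (fun t => pred_t F C r t.1 t.2 - (lagrangian F C (xx t) (y_ r t.1)
    - lagrangian F C (xx t + ss t) (y_ r t.1))) E.
Proof.
apply: (@dom_eq _ _ _ (fun t =>
  (half_sq F (xx t + ss t) - half_sq F (xx t)
    - dotv ((JF F r t.1)^T *m F (xx t)) (ss t))
  + `|dotv (y_ r t.1) (C (xx t + ss t)) - dotv (y_ r t.1) (C (xx t))
    - dotv ((Jc C r t.1)^T *m y_ r t.1) (ss t)|
  + (dotv (gr t) (ss t) + pred_t F C r t.1 t.2))) => [t tP|].
  have h1 := ler_norm (dotv (y_ r t.1) (C (xx t + ss t))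
    - dotv (y_ r t.1) (C (xx t)) - dotv ((Jc C r t.1)^T *m y_ r t.1) (ss t)).
  have -> : dotv (gr t) (ss t) = dotv ((JF F r t.1)^T *m F (xx t)) (ss t)
      + dotv ((Jc C r t.1)^T *m y_ r t.1) (ss t) by rewrite -dotvDl.
  rewrite /lagrangian; lra.
apply: dom_add; last exact: dom_gradL_step.
exact: dom_add (dom_E2 dom_f_taylor) (dom_E2 dom_yC_taylor).
Qed.

(** Every term pairs a bounded vector with [n_] or [n_ - Wt n_], both O(|C|/gamma). In the last term
    gamma t is bounded because t = O(1/gamma). *)
Lemma dom_pred_l : dom
  (fun t => `|pred_l F C r t.1 t.2 - pred_t F C r t.1 t.2|)
  (fun t => cn t / g t).
Proof.
apply: (@dom_eq _ _ _ (fun t =>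
  2^-1 * `|dotv (Hmat F r t.1 t.2 *m nn t) (nn t)| + `|dotv (gr t) (nn t)|
  + 2^-1 * `|dotv (g t *: tg t + gv t) (nn t - Wt r t.1 t.2 (nn t))|)) => [t tP|].
  rewrite /pred_l.
  set a := dotv (Hmat _ _ _ _ *m _) _; set b := dotv (gr t) _.
  set e := dotv (g t *: _ + _) _.
  have -> : - (2^-1 * a) - b + pred_t F C r t.1 t.2 + 2^-1 * e
    - pred_t F C r t.1 t.2 = - (2^-1 * a) - b + 2^-1 * e by lra.
  apply: le_trans (ler_normD _ _) _; apply: lerD.
    apply: le_trans (ler_normB _ _) _.
    by rewrite normrN normrM gtr0_norm// invr_gt0.
  by rewrite normrM gtr0_norm// invr_gt0.
apply: dom_add; first apply: dom_add.
- apply: dom_scale => //; apply: dom_dotv1 dom_n.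
  exact: dom_trans dom_H_n dom_C.
- exact: dom_dotv1 dom_gradL dom_n.
apply: dom_scale => //; apply: dom_dotv1.
  apply: (@dom_eq _ _ _ (fun t => g t * enorm (tg t) + enorm (gv t))) => [t tP|].
    by apply: le_trans (ler_enormD _ _) _; rewrite enormZ gtr0_norm ?gam_gt0.
  apply: dom_add dom_gvec; have [K K0 hK] := dom_t; exists K => // t tP.
  by rewrite mulr1 mulrC -ler_pdivlMr ?gam_gt0//; apply: hK.
have [K K0 hK] := Wt_bounded.
apply: dom_trans dom_n; exists (1 + K) => [|t tP]; first by rewrite addr_ge0.
by apply: le_trans (ler_enormB _ _) _; rewrite mulrDl mul1r lerD2l hK.
Qed.

Lemma trial_boundsP : exists2 K, 1 <= K & forall j i, (i <= rej r j)%N ->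
  trial_bounds F C r K j i.
Proof.
have C0 t : 0 <= cn t by exact: enorm_ge0.
have C2g t : trial t -> 0 <= cn t ^+ 2 / g t.
  by move=> tP; rewrite mulr_ge0 ?sqr_ge0 ?gamV_ge0.
have Cg t : trial t -> 0 <= cn t / g t.
  by move=> tP; rewrite mulr_ge0 ?gamV_ge0.
have E0 t : trial t -> 0 <= E t.
  by move=> tP; rewrite addr_ge0 ?Cg ?gamV2_ge0.
(* Each field holds for all large K, and there are finitely many fields. *)
near (+oo : set_system R) => K; exists K.
  by near: K; exact: nbhs_pinfty_ge.
move=> j i ij; move: (ij : trial (j, i)).
set t := (j, i); rewrite -[j]/t.1 -[i]/t.2; move: t => t tP.
split; first by rewrite -[K]mulr1; move: t tP; near: K; exact: dom_near dom_gamV.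
- by rewrite -[K]mulr1; move: t tP; near: K; exact: dom_near dom_C.
- by move: t tP; near: K; apply: dom_near dom_pred_c_lower => t; exact: pred_c_ge0.
- by move: t tP; near: K; exact: dom_near dom_pred_c.
- by move: t tP; near: K; apply: dom_near dom_pred_t_lower => t; exact: pred_t_ge0.
- by move: t tP; near: K; apply: dom_near dom_pred_t => t; exact: gamV_ge0.
- move: t tP; near: K; apply: dom_near dom_ghat_dist => t tP.
  by rewrite addr_ge0 ?gamV_ge0.
- by move: t tP; near: K; exact: dom_near dom_pred_l.
- move: t tP; near: K; apply: dom_near dom_C_next => t tP.
  by rewrite addr_ge0 ?sqr_ge0// mulr_ge0// gamV2_ge0.
- by move: t tP; near: K; exact: dom_near dom_f_next.
- by move: t tP; near: K; exact: dom_near dom_lagrangian_next.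
Unshelve. all: by end_near. Qed.

End TrialEstimates.

(** * Real sequences: windowed descent, divergent sums, lower limits *)

Section Sequences.
Variable R : realType.

Lemma ratio_ge_expr (A : nat -> R) al i n : 0 <= al ->
  (forall j, al * A j <= A j.+1) -> al ^+ n * A i <= A (i + n)%N.
Proof.
move=> al0 h; elim: n => [|n IH]; first by rewrite expr0 mul1r addn0.
rewrite exprS -mulrA addnS; apply: le_trans (h _).
by rewrite ler_wpM2l.
Qed.

(* Since A decreases at most geometrically, the sum of A over a window ending
   at j is at most a fixed multiple of A j, which the decrease at j pays for. *)
Lemma window_descent_unbounded (f A : nat -> R) al kap nu N :
  (0 < nu)%N -> 0 < al <= 1 -> 0 < kap -> (forall j, 0 < A j) ->
  (forall j, al * A j <= A j.+1) ->
  (forall j, 0 <= f j) ->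
  (forall j, (N <= j)%N -> exists l,
     [/\ (l <= j)%N, (j < l + nu)%N & f j.+1 <= f l - kap * A j]) ->
  exists M, forall j, \sum_(N <= i < j) A i <= M.
Proof.
move=> nu0 /andP[al0 al1] kap0 A0 hA f0 hf.
pose M := \sum_(0 <= i < N.+1) f i.
pose th := kap * (al ^+ nu / nu%:R).
have nuR : 0 < nu%:R :> R by rewrite ltr0n.
have th0 : 0 < th by rewrite mulr_gt0// divr_gt0// exprn_gt0.
(* Invariant of a strong induction, since the descent refers to an earlier index [l]. [M] bounds
   every value up to index [N], before descent is available. *)
suff h j : f j <= M - th * \sum_(N <= i < j) A i.
  exists (M / th) => j; rewrite ler_pdivlMr// mulrC.
  by have := h j; have := f0 j; lra.
elim/ltn_ind: j => -[|j] IH.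
  rewrite big_geq// mulr0 subr0 /M big_nat_recl// lerDl.
  by apply: sumr_ge0.
have [jN|Nj] := ltnP j N.
  rewrite [X in th * X]big_geq// mulr0 subr0 /M big_mkord.
  have jN1 : (j.+1 < N.+1)%N by [].
  by rewrite (bigD1 (Ordinal jN1))//= lerDl sumr_ge0.
have [l [lj jl hl]] := hf j Nj.
apply: le_trans hl _.
have := IH l lj.
suff : th * (\sum_(N <= i < j.+1) A i - \sum_(N <= i < l) A i) <= kap * A j.
  lra.
have hwin i : (i <= j)%N -> (l <= i)%N -> A i <= A j / al ^+ nu.
  move=> ij li; rewrite ler_pdivlMr ?exprn_gt0// mulrC.
  have := ratio_ge_expr i (j - i) (ltW al0) hA; rewrite subnKC//.
  apply: le_trans; rewrite ler_wpM2r ?(ltW (A0 _))//.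
  rewrite -(subnKC (_ : j - i <= nu)%N).
    by rewrite exprD ler_piMr ?exprn_ge0 ?exprn_ile1// ltW.
  by rewrite leq_subLR (leq_trans (ltnW jl))// leq_add2r.
have hsum a b : (l <= a)%N -> (b <= j.+1)%N ->
    \sum_(a <= i < b) A i <= (b - a)%:R * (A j / al ^+ nu).
  move=> la bj; rewrite mulr_natl -sumr_const_nat.
  rewrite big_nat [X in _ <= X]big_nat; apply: ler_sum => i /andP[ai ib].
  apply: hwin; last exact: leq_trans ai.
  by rewrite -ltnS (leq_trans ib).
have hq : 0 <= A j / al ^+ nu by rewrite divr_ge0 ?exprn_ge0 ?ltW.
have -> : kap * A j = th * (nu%:R * (A j / al ^+ nu)).
  by rewrite /th; field; rewrite !gt_eqF ?exprn_gt0.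
rewrite ler_pM2l//.
apply: le_trans (_ : _ <= (j.+1 - l)%:R * (A j / al ^+ nu)) _; last first.
  by rewrite ler_wpM2r// ler_nat leq_subLR.
have [lN|Nl] := leqP l N.
  rewrite [X in _ - X]big_geq// subr0; apply: le_trans (hsum _ _ lN (leqnn _)) _.
  by rewrite ler_wpM2r// ler_nat leq_sub2l.
rewrite (big_cat_nat (n := l)) ?(ltnW Nl)//=; last exact: leqW.
by rewrite addrAC subrr add0r hsum.
Qed.

(** Splitting off one power, a^et = a^(et - 1) a <= B a with [B] = (a 0)^(et - 1), so the sum of a
    dominates a multiple of the divergent one. *)
Lemma sum_powR_unbounded (a : nat -> R) et :
  1 <= et -> (forall k, 0 < a k) -> (forall k, a k <= a 0%N) ->
  (\sum_(0 <= i < k) a i `^ et) @[k --> \oo] --> +oo ->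
  forall n M, exists k, M < \sum_(n <= i < k) a i.
Proof.
move=> et1 a0 ha /cvgryPgt hS n M.
pose B := a 0%N `^ (et - 1).
have B0 : 0 < B by rewrite powR_gt0.
have [k _ hk] := hS (B * (`|M| + \sum_(0 <= i < n) a i)).
exists (maxn k n); have {}hk := hk _ (leq_maxl k n).
rewrite -(ltrD2l (\sum_(0 <= i < n) a i)) -big_cat_nat ?leq_maxr//=.
rewrite addrC; apply: le_lt_trans (_ : _ <= `|M| + \sum_(0 <= i < n) a i) _.
  by rewrite lerD2r ler_norm.
rewrite -(ltr_pM2l B0); apply: lt_le_trans hk _.
rewrite mulr_sumr; apply: ler_sum => i _.
rewrite -[in X in X <= _](subrK 1 et) powRD; last by rewrite (gt_eqF (a0 i)) implybT.
rewrite powRr1 ?ler_wpM2r ?(ltW (a0 i))//.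
by rewrite ge0_ler_powR ?nnegrE ?subr_ge0// ltW.
Qed.

(** Every tail infimum already vanishes, so [einfs] is constant. *)
Lemma limn_einf_eq0 (u : nat -> R) : (forall j, 0 <= u j) ->
  (forall eps, 0 < eps -> forall N, exists2 j, (N <= j)%N & u j < eps) ->
  limn_einf (fun j => (u j)%:E) = 0%E.
Proof.
move=> u0 h; rewrite limn_einf_lim.
suff -> : einfs (fun j => (u j)%:E) = cst 0%E by rewrite lim_cst.
apply/funext => n; apply/eqP; rewrite eq_le; apply/andP; split.
  apply/lee_addgt0Pr => e e0; rewrite add0e.
  have [j nj uj] := h e e0 n.
  apply: le_trans (_ : _ <= (u j)%:E)%E _; last by rewrite lee_fin ltW.
  by apply: ereal_inf_lbound; exists j.
by apply: le_ereal_inf_tmp => _ [j _ <-]; rewrite lee_fin.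
Qed.

End Sequences.

(** * Convex combinations over a window *)

Section WeightedSums.
Variable R : realType.
Implicit Types (a v : nat -> R) (w k : nat).

Lemma sum_ge_term a w k : (k < w)%N -> (forall i, (i < w)%N -> 0 <= a i) ->
  a k <= \sum_(0 <= i < w) a i.
Proof.
move=> kw a0; rewrite big_mkord (bigD1 (Ordinal kw))//= lerDl.
by apply: sumr_ge0 => i _; exact: a0.
Qed.

(** If all terms were below the average [S], the weighted sum of the gaps [S - v k], which is zero,
    would contain a positive term and no negative one. *)
Lemma exists_ge_weighted_avg a v w :
  (forall k, (k < w)%N -> 0 < a k) -> \sum_(0 <= k < w) a k = 1 ->
  exists2 k, (k < w)%N & \sum_(0 <= k < w) a k * v k <= v k.
Proof.
move=> a0 a1; set S := \sum_(_ <= _ < _) _ * _; apply: contrapT => hn.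
have hlt k : (k < w)%N -> v k < S.
  by move=> kw; rewrite ltNge; apply/negP => hk; apply: hn; exists k.
have w0 : (0 < w)%N.
  case: (w) a1 => // /esym/eqP; rewrite big_geq// => /eqP.
  by have := @oner_neq0 R => /eqP.
have : 0 <= \sum_(0 <= k < w) a k * (v k - S).
  under eq_bigr do rewrite mulrBr.
  by rewrite sumrB -mulr_suml a1 mul1r subrr.
have : \sum_(0 <= k < w) a k * (S - v k) >= a 0%N * (S - v 0%N).
  apply: (@sum_ge_term (fun k => a k * (S - v k))) => // k kw.
  by rewrite mulr_ge0 ?subr_ge0 ?ltW ?a0 ?hlt.
have -> : \sum_(0 <= k < w) a k * (S - v k) = - \sum_(0 <= k < w) a k * (v k - S).
  by rewrite -sumrN; apply: eq_bigr => k _; rewrite -mulrN opprB.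
have : 0 < a 0%N * (S - v 0%N) by rewrite mulr_gt0 ?subr_gt0 ?a0 ?hlt.
lra.
Qed.

(** Index 0, the current iterate, has weight at least [mu], so its slack below [B] lowers the
    average by at least [mu] times that slack. *)
Lemma weighted_avg_le a v w mu B : (0 < w)%N -> 0 <= mu ->
  (forall k, (k < w)%N -> mu <= a k) -> \sum_(0 <= k < w) a k = 1 ->
  (forall k, (k < w)%N -> v k <= B) ->
  \sum_(0 <= k < w) a k * v k <= B - mu * (B - v 0%N).
Proof.
move=> w0 mu0 ha a1 hv.
have h1 : a 0%N * (B - v 0%N) <= \sum_(0 <= k < w) a k * (B - v k).
  apply: (@sum_ge_term (fun k => a k * (B - v k))) => // k kw.
  by rewrite mulr_ge0 ?subr_ge0 ?hv// (le_trans mu0)// ha.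
have h2 : \sum_(0 <= k < w) a k * (B - v k) = B - \sum_(0 <= k < w) a k * v k.
  under eq_bigr do rewrite mulrBr.
  by rewrite sumrB -mulr_suml a1 mul1r.
have : mu * (B - v 0%N) <= a 0%N * (B - v 0%N).
  by rewrite ler_wpM2r ?subr_ge0 ?hv ?ha.
lra.
Qed.

End WeightedSums.

Lemma leq_window_sub N n k j :
  (k < n)%N -> (N + n <= j)%N -> (N <= j - k)%N.
Proof. by lia. Qed.

(** Later windows look back no further than the window at [j]: either that one already reaches index
    0, or it has the full length [n], which no later window exceeds. *)
Lemma leq_window_prev (i j k n : nat) : (j <= i)%N -> (k < minn i.+1 n)%N ->
  (j < (i - k) + minn j.+1 n)%N.
Proof. by lia. Qed.

(** * A run with [ghat] bounded away from zero: the constraint test *)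

Section BoundedAwayRun.
Variables (R : realType) (d m p : nat).
Variables (F : 'cV[R]_d -> 'cV[R]_m) (C : 'cV[R]_d -> 'cV[R]_p).
Variables (c : constants R) (r : run R d p).
Hypothesis cP : valid_constants m c.
Hypothesis rP : lm_run F C c r.
Variables (K ky eps : R) (J0 : nat).
Hypothesis K1 : 1 <= K.
Hypothesis bnd : forall j i, (i <= rej r j)%N -> trial_bounds F C r K j i.
Hypothesis ky0 : 0 < ky.
Hypothesis kyP : forall j, enorm (y_ r j) <= ky.
Hypothesis eps0 : 0 < eps.
Hypothesis heps : forall j, (J0 <= j)%N -> eps <= enorm (ghat F C r j (rej r j)).

Local Notation cn j := (enorm (C (x_ r j))).
Local Notation q j i := (gam r j i)^-1.
Local Notation h j i := (enorm (ghat F C r j i)).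
Local Notation pc j i := (pred_c C r j i).
Local Notation pt j i := (pred_t F C r j i).
Local Notation pl j i := (pred_l F C r j i).
Local Notation cnext j i := (enorm (C (x_ r j + step r j i))).
Local Notation L j := (lagrangian F C (x_ r j) (y_ r j)).
Local Notation A j := (a_ c (k_ r j)).

Let K0 : 0 < K. Proof. exact: lt_le_trans K1. Qed.

Let gP j i : (i <= rej r j)%N -> 0 < gam r j i.
Proof. exact: (@gam_gt0 _ _ _ _ _ _ _ _ cP rP (j, i)). Qed.

Let q0 j i : (i <= rej r j)%N -> 0 < q j i.
Proof. by move=> ij; rewrite invr_gt0 gP. Qed.

Let c0 j : 0 <= cn j. Proof. exact: enorm_ge0. Qed.

Let pc0 j i : (i <= rej r j)%N -> 0 <= pc j i.
Proof. exact: (@pred_c_ge0 _ _ _ _ _ _ _ _ cP rP (j, i)). Qed.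

Let pc_le j i : (i <= rej r j)%N -> pc j i <= 2^-1 * cn j ^+ 2.
Proof. exact: (@pred_c_le _ _ _ _ _ _ _ _ cP rP (j, i)). Qed.

Lemma gam_le_rej j i : (i <= rej r j)%N -> gam r j i <= gam r j (rej r j).
Proof.
have [_ _ /(_ j)[_ _ _ hrej _]] := rP; have [_ [_ gh2 _] _ _ _] := cP.
suff hn n : (i + n <= rej r j)%N -> gam r j i <= gam r j (i + n).
  by move=> ij; rewrite -(subnKC ij) hn// subnKC.
elim: n => [|n IH] ij; first by rewrite addn0.
rewrite addnS in ij *; have [_ ->] := hrej _ ij.
apply: le_trans (IH (ltnW ij)) _; rewrite ler_peMl ?ltW//.
exact: gP (ltnW ij).
Qed.

(** The bound eps is assumed at accepted trials only. Both [ghat] lie within eps/4 of [W_ *m gradL],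
    the accepted one because rejections only increase gamma. *)
Lemma ghat_ge_half j i : (J0 <= j)%N -> (i <= rej r j)%N ->
  cn j + q j i <= eps / (4 * K) -> eps / 2 <= h j i.
Proof.
move=> Jj ij hc; have b1 := ghat_dist (bnd ij).
have b2 := ghat_dist (bnd (leqnn (rej r j))).
have he := heps Jj.
have qq : q j (rej r j) <= q j i by rewrite lef_pV2 ?posrE ?gP// gam_le_rej.
have hK : K * (cn j + q j i) <= eps / 4.
  have -> : eps / 4 = K * (eps / (4 * K)) by field; rewrite gt_eqF.
  by rewrite ler_pM2l.
have hK2 : K * (cn j + q j (rej r j)) <= eps / 4.
  by apply: le_trans hK; rewrite ler_pM2l// lerD2l.
set w := W_ r j *m gradL F C r j in b1 b2.
have := ler_enormD (ghat F C r j (rej r j) - w) (w - ghat F C r j i + ghat F C r j i).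
rewrite subrK subrK.
have := ler_enormD (w - ghat F C r j i) (ghat F C r j i).
rewrite subrK (enormB_sym w); lra.
Qed.

Lemma C_next_le j i : (i <= rej r j)%N ->
  cnext j i ^+ 2 <= cn j ^+ 2 - 2 * pc j i + K * (cn j * q j i ^+ 2 + q j i ^+ 4).
Proof.
move=> ij; have := C_next_bound (bnd ij).
by rewrite -!exprVn -exprM lerBlDl.
Qed.

(** Relaxation means |C| < alpha a_k and |C| < beta |ghat| with alpha and beta below 1, so both
    candidates for [Rj] are above |C|^2. *)
Lemma Rj_ge j i : cn j ^+ 2 <= Rj F C c r j i.
Proof.
rewrite /Rj; case: ifP => // /=; rewrite /relaxed !lt_min => /andP[h1 h2].
have [_ _ [/andP[al0 al1] /andP[be0 be1] _] _ [_ _ _ _ [_ [a0 _ _ _]]]] := cP.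
rewrite le_min !ler_pXn2r ?nnegrE ?enorm_ge0// ?(ltW (a0 _))//.
apply/andP; split; apply: ltW.
  by apply: lt_trans h1 _; rewrite gtr_pMl ?a0//; lra.
have hp : 0 < h j i by rewrite -(pmulr_rgt0 _ be0) (le_lt_trans (c0 j)).
by apply: lt_trans h2 _; rewrite gtr_pMl//; lra.
Qed.

(** When |C| is at least a large multiple of 1/gamma, the error K(|C|/gamma^2 + 1/gamma^4) is at
    most the fraction [w] = 1 - rho1 of [pred_c], which is of order |C|^2/gamma. *)
Lemma rared_c_large_C : exists2 k1, 0 < k1 & forall j i, (i <= rej r j)%N ->
  k1 * q j i <= cn j -> rho1 c * pc j i <= rared_c F C c r j i.
Proof.
have [[/andP[rho0 rho1P] _] _ _ _ _] := cP; pose w : R := 1 - rho1 c.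
have w0 : 0 < w by rewrite /w; lra.
have hk1 : 1 <= K ^+ 2 * (1 + K) / w.
  rewrite ler_pdivlMr// mul1r.
  have : 1 + K <= K ^+ 2 * (1 + K).
    by rewrite ler_peMl ?exprn_ege1// addr_ge0 ?ltW.
  have := K1; rewrite /w; lra.
exists (K ^+ 2 * (1 + K) / w); first exact: lt_le_trans hk1.
move=> j i ij hc.
have hq := q0 ij; have hp := pred_c_lower (bnd ij); have hn := C_next_le ij.
have qK := gamV_bound (bnd ij).
have := pc0 ij; have := Rj_ge j i; have := c0 j.
set cj := cn j in hc hp hn *; set qq := q j i in hc hp hn hq qK *.
set P := pc j i in hp hn *; set X := cnext j i in hn * => cj0 hR P0.
have qc : qq <= cj by apply: le_trans hc; rewrite ler_peMl// ltW.
have h1 : K ^+ 2 * (1 + K) * qq <= w * cj.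
  by move: hc; rewrite mulrAC ler_pdivrMr// (mulrC cj).
have h2 : K ^+ 2 * (1 + K) * qq * cj <= w * cj * cj by rewrite ler_wpM2r.
have h3 : qq ^+ 3 <= K * (qq * cj).
  have qq0 := ltW hq; rewrite exprS; apply: ler_pM => //; first exact: sqr_ge0.
  by rewrite expr2 ler_wpM2l.
have h4 : K ^+ 2 * (cj * qq + qq ^+ 3) <= w * cj * cj.
  apply: le_trans h2; have -> : K ^+ 2 * (1 + K) * qq * cj =
    K ^+ 2 * (cj * qq + K * (qq * cj)) by ring.
  by rewrite ler_wpM2l ?sqr_ge0// lerD2l.
have h5 : K ^+ 2 * (cj * qq + qq ^+ 3) * qq <= w * (K * P).
  apply: le_trans (_ : _ <= w * cj * cj * qq) _; first by rewrite ler_wpM2r ?(ltW hq).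
  by rewrite -!mulrA ler_pM2l// mulrA -expr2.
have h6 : K * (cj * qq ^+ 2 + qq ^+ 4) <= w * P.
  rewrite -(ler_pM2l K0); have -> : K * (w * P) = w * (K * P) by ring.
  by apply: le_trans h5; rewrite le_eqVlt; apply/orP; left; apply/eqP; ring.
rewrite /rared_c.
have : Rj F C c r j i <= Num.max (Rj F C c r j i) (avg_c C c r j).
  by rewrite le_max lexx.
have : 0 <= w * P by rewrite mulr_ge0// ltW.
rewrite -/P -/X; rewrite /w in h6 *; lra.
Qed.

Lemma a_gt0 k : 0 < a_ c k.
Proof. by have [_ _ _ _ [_ _ _ _ [_ []]]] := cP. Qed.

Lemma a_decr k : a_ c k.+1 <= a_ c k.
Proof.
have [_ _ _ _ [_ _ _ _ [_ [_ /(_ k)/andP[_ + ] _ _]]]] := cP.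
by rewrite ltr_pdivrMr ?a_gt0// mul1r => /ltW.
Qed.

Lemma a_le0 k : a_ c k <= a_ c 0%N.
Proof. by elim: k => // k; apply: le_trans; exact: a_decr. Qed.

(** Here [pred_c] may be too small to pay for the error, and the relaxed target pays instead:
    |C_next|^2 = O(1/gamma^2), while for 1/gamma <= tau a_k the relaxation is active and [Rj] is at
    least a large multiple of 1/gamma^2. *)
Lemma rared_c_small_C k1 : 0 < k1 -> exists2 tau, 0 < tau & forall j i,
  (J0 <= j)%N -> (i <= rej r j)%N ->
  cn j <= k1 * q j i -> q j i <= tau * A j ->
  rho1 c * pc j i <= rared_c F C c r j i.
Proof.
move=> k10.
have [[/andP[rho0 rho1P] _] _ [/andP[al0 _] /andP[be0 _] _] _ _] := cP.
have a00 := a_gt0 0.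
(* [k2] collects the coefficients of 1/gamma^2 in |C|^2 and in the error of [C_next_le]; the summand
   1 ensures [k2 <= k2 ^+ 2]. *)
pose k2 := 1 + 2 * k1 ^+ 2 + K * (k1 * K + K ^+ 2).
have k21 : 1 <= k2.
  by rewrite /k2 -addrA lerDl !(addr_ge0, mulr_ge0, sqr_ge0)// ltW.
have k20 : 0 < k2 by exact: lt_le_trans k21.
(* [t1] and [t2] keep k2/gamma below a_k and eps/2, hence its square below [Rj]; [t3] and [t4]
   activate the relaxation; [t5] is the smallness required by [ghat_ge_half]. *)
near ((0:R)^'+) => tau.
have tau0 : 0 < tau by near: tau; exact: nbhs_right_gt.
have t1 : k2 * tau <= 1.
  rewrite mulrC -ler_pdivlMr//; near: tau; apply: nbhs_right_le.
  by rewrite divr_gt0.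
have t2 : k2 * (tau * a_ c 0%N) <= eps / 2.
  rewrite mulrCA -ler_pdivlMr ?mulr_gt0//; near: tau; apply: nbhs_right_le.
  by rewrite !divr_gt0 ?mulr_gt0.
have t3 : k1 * tau < alpha c.
  rewrite mulrC -ltr_pdivlMr//; near: tau; apply: nbhs_right_lt.
  by rewrite divr_gt0.
have t4 : k1 * (tau * a_ c 0%N) < beta c * (eps / 2).
  rewrite mulrCA -ltr_pdivlMr ?mulr_gt0//; near: tau; apply: nbhs_right_lt.
  by rewrite !divr_gt0 ?mulr_gt0 ?divr_gt0.
have t5 : (k1 + 1) * (tau * a_ c 0%N) <= eps / (4 * K).
  rewrite mulrCA -ler_pdivlMr ?mulr_gt0 ?addr_gt0//.
  near: tau; apply: nbhs_right_le.
  by rewrite !divr_gt0 ?mulr_gt0 ?addr_gt0.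
exists tau => // j i Jj ij hc hq.
have hA : tau * A j <= tau * a_ c 0%N by rewrite ler_pM2l// a_le0.
have hA0 : 0 < A j := a_gt0 _.
have h1 : cn j <= k1 * (tau * A j) by apply: le_trans hc _; rewrite ler_pM2l.
have h2 : k1 * (tau * A j) <= k1 * (tau * a_ c 0%N) by rewrite ler_pM2l.
have hh : eps / 2 <= h j i by apply: ghat_ge_half => //; lra.
have rel : relaxed F C c r j i.
  rewrite /relaxed lt_min; apply/andP; split.
    by apply: le_lt_trans h1 _; rewrite mulrA ltr_pM2r.
  apply: le_lt_trans h1 _; apply: le_lt_trans h2 _; apply: lt_le_trans t4 _.
  by rewrite ler_pM2l.
have hq0 := q0 ij; have qK := gamV_bound (bnd ij); have hn := C_next_le ij.
have pcl := pc_le ij; have pcp := pc0 ij.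
have hRj : (k2 * q j i) ^+ 2 <= Rj F C c r j i.
  rewrite /Rj rel le_min; apply/andP; split.
    rewrite ler_pXn2r ?nnegrE ?mulr_ge0 ?(ltW hA0) ?(ltW k20) ?(ltW hq0)//.
    apply: le_trans (_ : _ <= k2 * (tau * A j)) _; first by rewrite ler_pM2l.
    by rewrite mulrA ler_piMl// ltW.
  rewrite ler_pXn2r ?nnegrE ?mulr_ge0 ?enorm_ge0 ?(ltW k20) ?(ltW hq0)//.
  apply: le_trans hh; apply: le_trans t2; rewrite ler_pM2l//.
  exact: le_trans hA.
rewrite /rared_c.
have : Rj F C c r j i <= Num.max (Rj F C c r j i) (avg_c C c r j).
  by rewrite le_max lexx.
have hk : k2 * q j i ^+ 2 <= (k2 * q j i) ^+ 2.
  by rewrite exprMn ler_wpM2r ?sqr_ge0// expr2 ler_peMl// ltW.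
move: hc hq0 qK hn pcl pcp hRj hk; have := c0 j.
move: (cn j) (q j i) (pc j i) (cnext j i) (Rj F C c r j i) => cj qq P X Rv.
move=> cj0 hc qq0 qK hn Pc P0 hRv hk hmax.
have e1 : cj ^+ 2 <= k1 ^+ 2 * qq ^+ 2.
  by rewrite -exprMn ler_pXn2r ?nnegrE ?mulr_ge0 ?(ltW k10) ?(ltW qq0).
have e2 : cj * qq ^+ 2 <= k1 * K * qq ^+ 2.
  rewrite ler_wpM2r ?sqr_ge0//; apply: le_trans hc _.
  by rewrite ler_pM2l.
have e3 : qq ^+ 4 <= K ^+ 2 * qq ^+ 2.
  have -> : qq ^+ 4 = qq ^+ 2 * qq ^+ 2 by rewrite -exprD.
  by rewrite ler_wpM2r ?sqr_ge0// ler_pXn2r ?nnegrE// ltW.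
have e4 : K * (cj * qq ^+ 2 + qq ^+ 4) <= K * (k1 * K + K ^+ 2) * qq ^+ 2.
  rewrite -mulrA ler_pM2l//; lra.
have e5 : rho1 c * P <= P by rewrite ler_piMl// ltW.
have e6 : 0 <= qq ^+ 2 by rewrite sqr_ge0.
rewrite /k2 in hk hRv; lra.
Unshelve. all: by end_near. Qed.

(** * The Lagrangian test, and the bound on gamma *)

Let xi01 : 0 < xi c < 1.
Proof.
have [_ _ [_ _ /andP[x0 ->]] _ _] := cP; rewrite andbT.
by apply: lt_trans x0; rewrite divr_gt0.
Qed.

(* The test gives pred_c^xi <= pred_t = O(1/gamma) while pred_c is of order
   |C|^2/gamma; as xi < 1, this forces C to vanish as gamma grows. *)
Lemma C_small_of_test s : 0 < s -> exists2 de, 0 < de & forall j i,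
  (i <= rej r j)%N -> tangential_test F C c r j i -> q j i <= de -> cn j <= s.
Proof.
move=> s0; have /andP[x0 x1] := xi01.
have x1' : 0 < 1 - xi c by rewrite subr_gt0.
(* With q = 1/gamma, |C| > s would give T q^xi <= K q, that is T <= K q^(1 - xi); [B] keeps the
   right side at T/2 or less. *)
pose T := (s ^+ 2 / K) `^ xi c; pose B := T / (2 * K).
have T0 : 0 < T by rewrite powR_gt0// divr_gt0// exprn_gt0.
have B0 : 0 < B by rewrite divr_gt0// mulr_gt0.
exists (B `^ (1 - xi c)^-1); first by rewrite powR_gt0.
move=> j i ij /andP[+ _] hq; rewrite ge_max => /andP[_ test].
have hq0 := q0 ij; rewrite leNgt; apply/negP => sc.
have hpt := pred_t_upper (bnd ij).
have h1 : s ^+ 2 / K * q j i <= pc j i.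
  rewrite mulrAC ler_pdivrMr// (mulrC _ K); apply: le_trans (pred_c_lower (bnd ij)).
  rewrite ler_wpM2r ?(ltW hq0)// ler_pXn2r ?nnegrE ?enorm_ge0 ?ltW//.
have h2 : T * q j i `^ xi c <= K * q j i.
  apply: le_trans hpt; apply: le_trans test.
  rewrite -powRM ?(ltW hq0)//; last by rewrite divr_ge0 ?sqr_ge0 ?(ltW K0).
  apply: ge0_ler_powR; rewrite ?nnegrE ?(ltW x0) ?pc0//.
  by rewrite mulr_ge0 ?(ltW hq0)// divr_ge0 ?sqr_ge0 ?(ltW K0).
have h3 : q j i = q j i `^ (1 - xi c) * q j i `^ xi c.
  rewrite -powRD; last by rewrite (gt_eqF hq0) implybT.
  by rewrite subrK powRr1 ?(ltW hq0).
have h4 : q j i `^ (1 - xi c) <= B.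
  apply: le_trans (_ : _ <= (B `^ (1 - xi c)^-1) `^ (1 - xi c)) _.
    by apply: ge0_ler_powR => //; rewrite ?nnegrE ?powR_ge0 ?(ltW hq0) ?(ltW x1').
  by rewrite -powRrM mulVf ?gt_eqF// powRr1 ?(ltW B0).
have : T <= K * B.
  rewrite -(ler_pM2r (powR_gt0 (xi c) hq0)); apply: le_trans h2 _.
  by rewrite {1}h3 mulrA ler_wpM2r ?powR_ge0// ler_pM2l.
rewrite /B leNgt => /negP; apply.
have -> : K * (T / (2 * K)) = T / 2 by field; rewrite gt_eqF.
lra.
Qed.

(** The test gives pred_l >= rho2 pred_t, at least a multiple of eps^2/gamma, whereas the errors are
    O((|C| + 1/gamma)/gamma) and become a small fraction of it. *)
Lemma rared_l_small_C : exists2 si, 0 < si & forall j i,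
  (J0 <= j)%N -> (i <= rej r j)%N -> tangential_test F C c r j i ->
  cn j + q j i <= si -> rho1 c * pl j i <= rared_l F C c r j i.
Proof.
have [[/andP[rho0 rho1P] /andP[rho20 _]] _ _ _ _] := cP.
have w0 : 0 < 1 - rho1 c by rewrite subr_gt0.
pose B := (1 - rho1 c) * rho2 c * eps ^+ 2 / (8 * K ^+ 2).
exists (Num.min (eps / (4 * K)) B).
  by rewrite lt_min !divr_gt0 ?mulr_gt0 ?exprn_gt0.
move=> j i Jj ij /andP[_ test]; rewrite le_min => /andP[hs1 hs2].
have hq0 := q0 ij; have hh := ghat_ge_half Jj ij hs1.
have hpt := pred_t_lower (bnd ij).
have hL := lagrangian_next_bound (bnd ij).
have := pred_l_dist (bnd ij); rewrite ler_distl => /andP[_ hpl].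
rewrite -exprVn in hL.
have h1 : eps ^+ 2 / 4 * q j i <= K * pt j i.
  apply: le_trans hpt; rewrite ler_pM2r//.
  have -> : eps ^+ 2 / 4 = (eps / 2) ^+ 2 by field.
  by rewrite ler_pXn2r ?nnegrE ?enorm_ge0 ?divr_ge0 ?(ltW eps0).
have h2 : 2 * K * (q j i * (cn j + q j i)) <= (1 - rho1 c) * (rho2 c * pt j i).
  apply: le_trans (_ : _ <= 2 * K * (q j i * B)) _.
    by rewrite ler_pM2l ?mulr_gt0// ler_pM2l.
  have -> : 2 * K * (q j i * B) =
      (1 - rho1 c) * (rho2 c * (eps ^+ 2 / 4 * q j i / K)).
    by rewrite /B; field; rewrite !gt_eqF ?gP.
  by rewrite !ler_pM2l// ler_pdivrMr// (mulrC _ K).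
have h3 : (1 - rho1 c) * (rho2 c * pt j i) <= (1 - rho1 c) * pl j i.
  by rewrite ler_pM2l.
rewrite /rared_l.
have : L j <= Num.max (L j) (avg_l F C c r j) by rewrite le_max lexx.
have e1 : K * (cn j / gam r j i + (gam r j i)^-1 ^+ 2) + K * (cn j / gam r j i)
  <= 2 * K * (q j i * (cn j + q j i)).
  have : 0 <= K * q j i ^+ 2 by rewrite mulr_ge0 ?sqr_ge0 ?ltW.
  lra.
lra.
Qed.

(** The regimes of large and small |C| against k1/gamma cover the constraint test; for the
    Lagrangian test, [C_small_of_test] first makes |C| small. The threshold is on [A * gam] because
    the relaxation asks for 1/gamma <= tau a_k. *)
Lemma accepted_of_large_gam : exists2 G, 0 < G & forall j i,
  (J0 <= j)%N -> (i <= rej r j)%N -> G <= A j * gam r j i ->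
  accepted F C c r j i.
Proof.
have [k1 k10 hlarge] := rared_c_large_C.
have [tau tau0 hsmall] := rared_c_small_C k10.
have [si si0 hl] := rared_l_small_C.
have si20 : 0 < si / 2 by rewrite divr_gt0.
have [de de0 hde] := C_small_of_test si20.
have a00 := a_gt0 0.
pose G := tau^-1 + a_ c 0%N / de + a_ c 0%N / (si / 2).
have G1 : 0 < tau^-1 by rewrite invr_gt0.
have G2 : 0 < a_ c 0%N / de by rewrite divr_gt0.
have G3 : 0 < a_ c 0%N / (si / 2) by rewrite divr_gt0.
exists G => [|j i Jj ij hG]; first by rewrite !addr_gt0.
have gp := gP ij; have Ap := a_gt0 (k_ r j); have Aa := a_le0 (k_ r j).
(* As [A j <= a_ 0], the last two summands of [G] turn into upper bounds on 1/gamma. *)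
have hqof x : 0 < x -> a_ c 0%N / x <= G -> q j i <= x.
  move=> x0 hx; rewrite -[q j i]mul1r ler_pdivrMr// -ler_pdivrMl//.
  rewrite mulr1 -(ler_pM2l a00); apply: le_trans hx _; apply: le_trans hG _.
  by rewrite ler_pM2r.
rewrite /accepted; apply/andP; split.
  have [hc|hc] := leP (k1 * q j i) (cn j); first exact: hlarge.
  apply: hsmall (ltW hc) _ => //.
  rewrite -[q j i]mul1r ler_pdivrMr// -mulrA -ler_pdivrMl// mulr1.
  by apply: le_trans hG; rewrite /G -addrA lerDl addr_ge0 ?ltW.
apply/implyP => test; apply: hl => //.
have -> : si = si / 2 + si / 2 by lra.
apply: lerD; last by apply: hqof => //; rewrite /G lerDr addr_ge0 ?ltW.
apply: hde ij test _; apply: hqof => //.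
by rewrite /G addrAC lerDr addr_ge0 ?ltW.
Qed.

Lemma accepted_rej j : accepted F C c r j (rej r j).
Proof. by have [_ _ /(_ j)[_ _ _ _ []]] := rP. Qed.

Lemma k_next j : k_ r j.+1 =
  if relaxed F C c r j (rej r j) && (avg_c C c r j <= Rj F C c r j (rej r j))
  then (k_ r j).+1 else k_ r j.
Proof. by have [_ _ /(_ j)[_ _ _ _ [_ []]]] := rP. Qed.

Lemma A_decr j : A j.+1 <= A j.
Proof. by rewrite k_next; case: ifP => // _; exact: a_decr. Qed.

Lemma A_ratio j : alpha0 c * A j <= A j.+1.
Proof.
have [_ _ _ _ [_ _ _ /andP[al0 al1] [_ [_ aa _ _]]]] := cP.
rewrite k_next; case: ifP => _; last by rewrite ler_piMl// ltW// a_gt0.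
by have /andP[+ _] := aa (k_ r j); rewrite ler_pdivlMr// a_gt0.
Qed.

(** A rejected trial has [A * gam < G], so a rejection leaves the product below [ghat2 * G]. An
    acceptance lowers gamma or resets it to [gmin], and [A] never increases. The middle summand of
    [G'] covers the start at [J0]. *)
Lemma gam_upper : exists2 G, 0 < G & forall j i, (J0 <= j)%N ->
  (i <= rej r j)%N -> A j * gam r j i <= G.
Proof.
have [G G0 hG] := accepted_of_large_gam.
have [_ [/andP[gh0 gh1] gh2 gm0] _ _ _] := cP.
pose G' := ghat2 c * G + A J0 * gam r J0 0 + a_ c 0%N * gmin c.
have e1 : 0 < ghat2 c * G by rewrite mulr_gt0// (lt_trans ltr01).
have e2 : 0 < A J0 * gam r J0 0 by rewrite mulr_gt0 ?a_gt0 ?gP.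
have e3 : 0 < a_ c 0%N * gmin c by rewrite mulr_gt0 ?a_gt0.
exists G' => [|j]; first by rewrite !addr_gt0.
suff H : forall n i, (i <= rej r (J0 + n))%N -> A (J0 + n)%N * gam r (J0 + n) i <= G'.
  by move=> i Jj; move: (H (j - J0)%N i); rewrite subnKC.
have hstep k i : (i < rej r (J0 + k))%N ->
    A (J0 + k)%N * gam r (J0 + k) i.+1 <= G'.
  have [_ _ /(_ (J0 + k)%N)[_ _ _ hrej _]] := rP.
  move=> ij; have [na ->] := hrej _ ij.
  have : A (J0 + k)%N * gam r (J0 + k) i < G.
    rewrite ltNge; apply: contra na => hGk.
    by apply: hG hGk; rewrite ?leq_addr// ltnW.
  rewrite -(ltr_pM2l (lt_trans ltr01 gh2)) mulrCA => /ltW h1.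
  by apply: le_trans h1 _; rewrite /G' -addrA lerDl addr_ge0 ?ltW.
elim=> [|n IH] [|i] ij; try exact: hstep.
  by rewrite addn0 /G' addrAC lerDr addr_ge0 ?ltW.
rewrite addnS; have [_ _ /(_ (J0 + n)%N)[_ _ _ _ [_ [_ -> _]]]] := rP.
rewrite maxEle; case: ifP => _.
  apply: le_trans (IH _ (leqnn _)).
  rewrite mulrCA; apply: le_trans (_ : _ <= A (J0 + n).+1 * gam r (J0 + n) (rej r (J0 + n))) _.
    by rewrite ler_piMl ?mulr_ge0 ?ltW ?a_gt0 ?gP.
  by rewrite ler_pM2r ?gP// A_decr.
apply: le_trans (_ : _ <= a_ c 0%N * gmin c) _.
  by rewrite ler_pM2r// a_le0.
by rewrite /G' lerDr addr_ge0 ?ltW.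
Qed.

(** * Convergence of the constraint values to zero *)

Local Notation X j := (cn j ^+ 2).
Local Notation ra j := (rej r j).

Lemma x_next j : x_ r j.+1 = x_ r j + step r j (ra j).
Proof. by have [_ _ /(_ j)[_ _ _ _ [_ []]]] := rP. Qed.

Lemma mu_gt0 : 0 < mu c.
Proof. by have [_ _ _ _ [_ _ /andP[]]] := cP. Qed.

Lemma win_c_gt0 j : (0 < win_c c j)%N.
Proof. by have [_ _ _ _ [+ _ _ _ _]] := cP; rewrite /win_c leq_min. Qed.

Lemma weightsP j : valid_weights c r j.
Proof. by have [_ _ /(_ j)[]] := rP. Qed.

Lemma mu_le1 : mu c <= 1.
Proof.
have [hm _ h1 _] := weightsP 0; have w0 := win_c_gt0 0.
rewrite -h1; apply: le_trans (hm _ w0) _; apply: sum_ge_term => // i iw.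
exact: le_trans (ltW mu_gt0) (hm _ iw).
Qed.

Lemma X_next j :
  X j.+1 <= Num.max (Rj F C c r j (ra j)) (avg_c C c r j) - 2 * rho1 c * pc j (ra j).
Proof.
have /andP[+ _] := accepted_rej j; rewrite /rared_c -x_next; lra.
Qed.

Let pcr0 j : 0 <= 2 * rho1 c * pc j (ra j).
Proof. by have [[/andP[r0 _] _] _ _ _ _] := cP; rewrite !mulr_ge0 ?pc0// ltW. Qed.

Lemma avg_c_window_le j B : (forall k, (k < win_c c j)%N -> X (j - k)%N <= B) ->
  avg_c C c r j <= B - mu c * (B - X j).
Proof.
have [hm _ h1 _] := weightsP j => hB.
have := weighted_avg_le (win_c_gt0 j) (ltW mu_gt0) hm h1 hB.
by rewrite subn0.
Qed.

Lemma window_le_avg_c j k : (k < win_c c j)%N ->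
  X (j - k)%N <= avg_c C c r j / mu c.
Proof.
have [hm _ h1 _] := weightsP j => kw; rewrite ler_pdivlMr ?mu_gt0// mulrC.
apply: le_trans (_ : _ <= mu_c r j k * X (j - k)%N) _.
  by rewrite ler_wpM2r ?sqr_ge0// hm.
apply: (@sum_ge_term _ (fun k => mu_c r j k * X (j - k)%N)) => // i iw.
by rewrite mulr_ge0 ?sqr_ge0// (le_trans (ltW mu_gt0))// hm.
Qed.

(** Without increments a relaxed [Rj] stays below the window average, so the reference value is at
    most [max (X j) (avg_c j)]; bounded gamma makes [pred_c] at least a multiple of |C|^2. A bound
    [B] on a whole window then contracts by the factor [1 - et]. *)
Lemma C_cvg0_of_const_k J : (J0 <= J)%N ->
  (forall j, (J <= j)%N -> k_ r j.+1 = k_ r j) ->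
  forall e, 0 < e -> exists N, forall j, (N <= j)%N -> X j <= e.
Proof.
move=> JJ hk.
have kJ j : (J <= j)%N -> k_ r j = k_ r J.
  by move=> /subnKC <-; elim: (j - J)%N => [|n IH]; rewrite ?addn0// addnS hk ?leq_addr.
have [G G0 hG] := gam_upper.
have [[/andP[rho0 _] _] _ _ _ _] := cP.
pose th := 2 * rho1 c * (A J / (G * K)).
have th0 : 0 < th by rewrite /th mulr_gt0 ?divr_gt0 ?mulr_gt0 ?a_gt0.
have hpc j : (J <= j)%N -> th * X j <= 2 * rho1 c * pc j (ra j).
  move=> Jj; rewrite /th -mulrA ler_pM2l ?mulr_gt0//.
  have hp := pred_c_lower (bnd (leqnn (ra j))).
  have hg := hG j (ra j) (leq_trans JJ Jj) (leqnn _); rewrite kJ// in hg.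
  have qg : A J / G <= q j (ra j).
    by rewrite ler_pdivrMr// mulrC ler_pdivlMr ?gP.
  have -> : A J / (G * K) * X j = A J / G * X j / K by field; rewrite !gt_eqF.
  rewrite ler_pdivrMr// (mulrC _ K); apply: le_trans hp.
  by rewrite mulrC ler_wpM2l ?sqr_ge0.
have hmax j : (J <= j)%N -> Num.max (Rj F C c r j (ra j)) (avg_c C c r j)
    <= Num.max (X j) (avg_c C c r j).
  move=> Jj.
  have : ~~ (relaxed F C c r j (ra j) && (avg_c C c r j <= Rj F C c r j (ra j))).
    by apply/negP => hc; have := hk j Jj; rewrite k_next hc => /esym/n_Sn.
  rewrite /Rj; case: ifP => //= _; rewrite -ltNge => /ltW/max_idPr ->.
  by rewrite le_max lexx orbT.
(* Three ways to gain [et * B]: through [th] when X j >= B/2, and otherwise through [mu] for the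
   average and 1 for X j itself. *)
pose et := Num.min (Num.min th (mu c)) 1 / 2.
have et0 : 0 < et by rewrite divr_gt0// !lt_min th0 mu_gt0 ltr01.
have et1 : 2 * et <= th /\ 2 * et <= mu c /\ 2 * et <= 1.
  by rewrite mulrC divfK ?pnatr_eq0// !ge_min !lexx !orbT.
have [eth [emu e1]] := et1.
have hstep N B : (J <= N)%N -> 0 <= B -> (forall j, (N <= j)%N -> X j <= B) ->
    forall j, (N + nuc c < j)%N -> X j <= (1 - et) * B.
  move=> JN B0 hB [//|j]; rewrite ltnS => Nj.
  have Nj' : (N <= j)%N := leq_trans (leq_addr _ _) Nj.
  have Jj := leq_trans JN Nj'.
  have havg : avg_c C c r j <= B - mu c * (B - X j).
    apply: avg_c_window_le => k; rewrite /win_c leq_min => /andP[_ kn].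
    by apply: hB; exact: leq_window_sub kn Nj.
  have hX := X_next j; have hp := hpc j Jj; have hm := hmax j Jj.
  have XB := hB j Nj'; have X0 : 0 <= X j := sqr_ge0 _.
  have mu0 := mu_gt0.
  have [hs|hs] := leP (B / 2) (X j).
    have : Num.max (X j) (avg_c C c r j) <= B.
      rewrite ge_max XB /=; apply: le_trans havg _.
      by rewrite gerBl mulr_ge0 ?subr_ge0// ltW.
    have : th * (B / 2) <= th * X j by rewrite ler_pM2l.
    have : 2 * et * B <= th * B by rewrite ler_wpM2r.
    lra.
  have : Num.max (X j) (avg_c C c r j) <= (1 - et) * B.
    rewrite ge_max; apply/andP; split.
      have : 2 * et * B <= 1 * B by rewrite ler_wpM2r.
      lra.
    have : mu c * (B / 2) <= mu c * (B - X j) by rewrite ler_pM2l//; lra.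
    have : 2 * et * B <= mu c * B by rewrite ler_wpM2r.
    lra.
  have := pcr0 j; lra.
have et01 : 0 <= 1 - et by lra.
have hgeo l : exists N, (J <= N)%N /\ forall j, (N <= j)%N ->
    X j <= (1 - et) ^+ l * K ^+ 2.
  elim: l => [|l [N [JN hN]]].
    exists J; split=> // j _; rewrite expr0 mul1r.
    rewrite ler_pXn2r ?nnegrE ?enorm_ge0 ?(ltW K0)//.
    exact: C_bound (bnd (leqnn (ra j))).
  exists (N + nuc c).+1; split.
    by rewrite leqW// (leq_trans JN)// leq_addr.
  move=> j hj; rewrite (exprS (1 - et)) -mulrA; apply: hstep hN _ hj => //.
  by rewrite mulr_ge0 ?exprn_ge0// ltW.
move=> e e0.
have : ((1 - et) ^+ l @[l --> \oo] --> (0 : R)).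
  by apply: cvg_expr; rewrite ger0_norm//; lra.
move=> /cvgr0Pnorm_lt/(_ (e / K ^+ 2)).
rewrite divr_gt0 ?exprn_gt0// => /(_ isT)[l _ /(_ l (leqnn l))] /=.
rewrite ger0_norm ?exprn_ge0// ltr_pdivlMr ?exprn_gt0// => hl.
have [N [_ hN]] := hgeo l; exists N => j /hN; move=> /le_trans; apply.
exact: ltW.
Qed.

(** With [k_] constant, |C| would tend to zero while a_k and |ghat| stay bounded below, and then
    both conditions for an increment hold. *)
Lemma k_increments J : exists2 j, (J <= j)%N &
  relaxed F C c r j (ra j) && (avg_c C c r j <= Rj F C c r j (ra j)).
Proof.
apply: contrapT => hn.
have hk j : (maxn J J0 <= j)%N -> k_ r j.+1 = k_ r j.
  rewrite geq_max => /andP[Jj _]; rewrite k_next; case: ifP => // hj.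
  by exfalso; apply: hn; exists j.
have kJ j : (maxn J J0 <= j)%N -> k_ r j = k_ r (maxn J J0).
  by move=> /subnKC <-; elim: (j - _)%N => [|n IH]; rewrite ?addn0// addnS hk ?leq_addr.
have [_ _ [/andP[al0 _] /andP[be0 _] _] _ _] := cP.
pose a := A (maxn J J0); have a0 : 0 < a := a_gt0 _.
(* Halved because the relaxation test is strict. *)
pose b := Num.min (alpha c * a) (Num.min (beta c * eps) (Num.min a eps)) / 2.
have b0 : 0 < b by rewrite divr_gt0// !lt_min !mulr_gt0// a0.
have b1 : [/\ b < alpha c * a, b < beta c * eps, b <= a & b <= eps].
  have : 2 * b <= Num.min (alpha c * a) (Num.min (beta c * eps) (Num.min a eps)).
    by rewrite mulrC divfK ?pnatr_eq0.
  by rewrite !le_min => /and4P[]; split; lra.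
have [b1a b1b b1c b1d] := b1.
have [N hN] := C_cvg0_of_const_k (leq_maxr J J0) hk (exprn_gt0 2 b0).
pose j := maxn (maxn J J0) (N + nuc c).
have Jj : (maxn J J0 <= j)%N := leq_maxl _ _.
have Nj : (N + nuc c <= j)%N := leq_maxr _ _.
have jJ0 : (J0 <= j)%N := leq_trans (leq_maxr _ _) Jj.
apply: hn; exists j; first exact: leq_trans (leq_maxl _ _) Jj.
have he := heps jJ0.
have hb i : (N <= i)%N -> cn i <= b.
  by move=> /hN; rewrite ler_pXn2r ?nnegrE ?enorm_ge0 ?(ltW b0).
have rel : relaxed F C c r j (ra j).
  have cb : cn j <= b by apply: hb; apply: leq_trans Nj; rewrite leq_addr.
  rewrite /relaxed lt_min kJ//; apply/andP; split.
    exact: le_lt_trans b1a.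
  apply: le_lt_trans cb _; apply: lt_le_trans b1b _.
  by rewrite ler_pM2l.
rewrite rel /= /Rj rel.
apply: le_trans (_ : _ <= b ^+ 2) _.
  have hw k : (k < win_c c j)%N -> X (j - k)%N <= b ^+ 2.
    rewrite /win_c leq_min => /andP[_ kn]; apply: hN.
    exact: leq_window_sub kn Nj.
  apply: le_trans (avg_c_window_le hw) _.
  rewrite gerBl mulr_ge0 ?(ltW mu_gt0)// subr_ge0.
  by have := hw 0%N (win_c_gt0 j); rewrite subn0.
rewrite kJ// le_min !ler_pXn2r ?nnegrE ?enorm_ge0 ?(ltW b0) ?(ltW a0)//.
by rewrite b1c (le_trans b1d).
Qed.

Lemma k_mono i j : (i <= j)%N -> (k_ r i <= k_ r j)%N.
Proof.
move=> /subnKC <-; elim: (j - i)%N => [|n IH]; first by rewrite addn0.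
by rewrite addnS; apply: leq_trans IH _; rewrite k_next; case: ifP.
Qed.

Lemma k_unbounded n : exists J, (n <= k_ r J)%N.
Proof.
elim: n => [|n [J nJ]]; first by exists 0%N.
have [j Jj inc] := k_increments J; exists j.+1.
by rewrite k_next inc ltnS; apply: leq_trans nJ (k_mono Jj).
Qed.

Lemma a_mono i j : (i <= j)%N -> a_ c j <= a_ c i.
Proof.
move=> /subnKC <-; elim: (j - i)%N => [|n IH]; first by rewrite addn0.
by rewrite addnS; apply: le_trans (a_decr _) IH.
Qed.

(** At an increment avg_c <= Rj <= (A j)^2, and weights at least [mu] turn this into a bound on the
    window. The bound then reproduces itself: later [Rj] is an earlier |C|^2 or at most (A j)^2, and
    later windows look back no further. *)
Lemma C_window_after_increment j :
  relaxed F C c r j (ra j) && (avg_c C c r j <= Rj F C c r j (ra j)) ->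
  forall i, (j < i + win_c c j)%N -> X i <= A j ^+ 2 / mu c.
Proof.
move=> /andP[rel]; rewrite {1}/Rj rel => havg.
have mu0 := mu_gt0.
have hB : A j ^+ 2 <= A j ^+ 2 / mu c.
  by rewrite ler_pdivlMr// ler_piMr ?sqr_ge0 ?mu_le1.
elim/ltn_ind => i IH ji.
have [ij|] := leqP i j.
  have ki : (j - i < win_c c j)%N by rewrite ltn_subLR.
  have := window_le_avg_c ki; rewrite subKn// => /le_trans; apply.
  rewrite ler_pM2r ?invr_gt0//; apply: le_trans havg _.
  by rewrite ge_min lexx.
case: i IH ji => // i IH _; rewrite ltnS => ji.
have Bi : X i <= A j ^+ 2 / mu c.
  by apply: IH => //; have := leq_window_prev ji (win_c_gt0 i); rewrite subn0.
have := X_next i; have := pcr0 i.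
suff : Num.max (Rj F C c r i (ra i)) (avg_c C c r i) <= A j ^+ 2 / mu c by lra.
rewrite ge_max; apply/andP; split.
  rewrite /Rj; case: ifP => // _; rewrite ge_min; apply/orP; left.
  apply: le_trans hB; rewrite ler_pXn2r ?nnegrE ?(ltW (a_gt0 _))//.
  exact/a_mono/k_mono.
have := @avg_c_window_le i (A j ^+ 2 / mu c).
have : 0 <= mu c * (A j ^+ 2 / mu c - X i) by rewrite mulr_ge0 ?subr_ge0// ltW.
suff hw k : (k < win_c c i)%N -> X (i - k)%N <= A j ^+ 2 / mu c.
  by move=> h1 /(_ hw); lra.
move=> kw; apply: IH; first by rewrite ltnS leq_subr.
exact: leq_window_prev.
Qed.

Lemma C_cvg0 e : 0 < e -> exists N, forall j, (N <= j)%N -> cn j <= e.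
Proof.
move=> e0; have [_ _ _ _ [_ _ _ _ [_ [_ _ acvg _]]]] := cP.
(* The entry 1 gives (A j)^2 <= A j, so it suffices to have A j below e^2 mu. *)
have mu0 := mu_gt0; pose e' := Num.min 1 (e ^+ 2 * mu c).
have e'0 : 0 < e' by rewrite lt_min ltr01 mulr_gt0 ?exprn_gt0.
have /cvgr0Pnorm_lt/(_ e' e'0)[n _ /(_ n (leqnn n)) /=] := acvg.
rewrite gtr0_norm ?a_gt0// lt_min => /andP[an1 ane].
have [J nJ] := k_unbounded n.
have [j Jj /C_window_after_increment hj] := k_increments J.
exists j => i ji; rewrite -(@ler_pXn2r _ 2) ?nnegrE ?enorm_ge0 ?(ltW e0)//.
apply: le_trans (hj i _) _.
  by apply: leq_ltn_trans ji _; rewrite -addn1 leq_add2l win_c_gt0.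
rewrite ler_pdivrMr//; apply: le_trans (ltW ane).
have Aj : A j <= a_ c n by apply: a_mono; apply: leq_trans nJ (k_mono Jj).
have /le_trans : A j ^+ 2 <= A j; last by apply.
by rewrite expr2 ler_piMl ?(ltW (a_gt0 _))// (le_trans Aj)// ltW.
Qed.

(** * Descent of f along windows and the contradiction *)

Local Notation f j := (half_sq F (x_ r j)).

Let pt_rej j : (J0 <= j)%N -> eps ^+ 2 / K * q j (ra j) <= pt j (ra j).
Proof.
move=> Jj; have hp := pred_t_lower (bnd (leqnn (ra j))).
rewrite mulrAC ler_pdivrMr// (mulrC _ K); apply: le_trans hp.
rewrite ler_pM2r ?q0// ler_pXn2r ?nnegrE ?enorm_ge0 ?(ltW eps0)//.
exact: heps.
Qed.

(* No acceptance test is involved: for large gamma the step itself decreases f. *)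
Lemma f_next_large_gam j : (J0 <= j)%N ->
  cn j + q j (ra j) <= eps ^+ 2 / (2 * K ^+ 2) ->
  f j.+1 <= f j - eps ^+ 2 / (2 * K) * q j (ra j).
Proof.
move=> Jj hs; have hq := q0 (leqnn (ra j)).
have := f_next_bound (bnd (leqnn (ra j))); rewrite -x_next -exprVn.
have := pt_rej Jj.
have : K * (q j (ra j) * (cn j + q j (ra j))) <=
    K * (q j (ra j) * (eps ^+ 2 / (2 * K ^+ 2))).
  by rewrite ler_pM2l// ler_pM2l.
have -> : K * (q j (ra j) * (eps ^+ 2 / (2 * K ^+ 2))) =
    eps ^+ 2 / (2 * K) * q j (ra j).
  by field; rewrite !gt_eqF ?gP.
have -> : eps ^+ 2 / K * q j (ra j) = 2 * (eps ^+ 2 / (2 * K) * q j (ra j)).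
  by field; rewrite !gt_eqF ?gP.
lra.
Qed.

Lemma dotv_y_C_le j i : `|dotv (y_ r j) (C (x_ r i))| <= ky * cn i.
Proof.
by apply: le_trans (normr_dotv_le _ _) _; rewrite ler_wpM2r ?enorm_ge0.
Qed.

(** A weighted average is at most one of its terms, so the nonmonotone reference reduces to a single
    iterate of the window. *)
Lemma window_max_l j : exists l, [/\ (l <= j)%N, (j < l + nul c)%N &
  Num.max (L j) (avg_l F C c r j) <= L l].
Proof.
have [_ _ _ _ [_ nul0 _ _ _]] := cP.
have [_ hm _ h1] := weightsP j.
have [|k kw hk] := exists_ge_weighted_avg (fun k => L (j - k)%N) _ h1.
  by move=> k /hm; apply: lt_le_trans; exact: mu_gt0.
have [_|_] := leP (avg_l F C c r j) (L j).
  by exists j; split=> //; rewrite -addn1 leq_add2l.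
exists (j - k)%N; split=> //; first exact: leq_subr.
move: kw; rewrite /win_l leq_min => /andP[kj kn].
by rewrite -ltn_subLR ?leq_subr// subKn.
Qed.

Lemma f_window_descent : exists kap N, [/\ 0 < kap & forall j, (N <= j)%N ->
  exists l, [/\ (l <= j)%N, (j < l + nul c)%N & f j.+1 <= f l - kap * A j]].
Proof.
have [G G0 hG] := gam_upper.
have [[/andP[rho0 rho1P] /andP[rho20 rho21]] _ _ _ _] := cP.
have /andP[x0 x1] := xi01; have a00 := a_gt0 0.
have [_ _ _ _ [_ nul0 _ _ _]] := cP.
pose de := eps ^+ 2 / (4 * K ^+ 2).
have de0 : 0 < de by rewrite /de !divr_gt0 ?mulr_gt0 ?exprn_gt0.
pose T := eps ^+ 2 / K * de.
have T0 : 0 < T by apply: mulr_gt0 de0; rewrite divr_gt0 ?exprn_gt0.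
have Tx0 : 0 < T `^ (xi c)^-1 by rewrite powR_gt0.
pose D := rho1 c * rho2 c * T.
have D0 : 0 < D by rewrite /D; apply: mulr_gt0 T0; exact: mulr_gt0.
have deE : de = eps ^+ 2 / (4 * K ^+ 2) := erefl.
have TE : T = eps ^+ 2 / K * de := erefl.
have DE : D = rho1 c * rho2 c * T := erefl.
clearbody D; clearbody T; clearbody de.
(* [s] is the level under which |C| eventually stays. [s2] serves the case of large gamma; [s1],
   [s3], [s4], [s5] make the tangential test hold otherwise; [s6] keeps f and the Lagrangian within
   D/4. *)
near ((0:R)^'+) => s.
have s0 : 0 < s by near: s; exact: nbhs_right_gt.
have s1 : s <= 1 by near: s; exact: nbhs_right_le.
have s2 : s <= de by near: s; exact: nbhs_right_le.
have s3 : s <= T / K ^+ 2.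
  by near: s; apply: nbhs_right_le; rewrite divr_gt0 ?exprn_gt0.
have s4 : s <= T `^ (xi c)^-1 / K ^+ 2.
  by near: s; apply: nbhs_right_le; rewrite divr_gt0 ?exprn_gt0.
have s5 : s <= (1 - rho2 c) * eps ^+ 2 / K ^+ 2.
  near: s; apply: nbhs_right_le.
  by rewrite divr_gt0 ?mulr_gt0 ?exprn_gt0 ?subr_gt0.
have s6 : s <= D / (4 * ky).
  by near: s; apply: nbhs_right_le; rewrite divr_gt0 ?mulr_gt0.
have [N hN] := C_cvg0 s0.
(* One entry per case: 1/gamma >= A/G for large gamma, and a fixed decrease D/2 with A <= a_0 for
   bounded gamma. *)
pose kap := Num.min (eps ^+ 2 / (2 * K) / G) (D / 2 / a_ c 0%N).
have kap1 : kap <= eps ^+ 2 / (2 * K) / G by rewrite ge_min lexx.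
have kap2 : kap <= D / 2 / a_ c 0%N by rewrite ge_min lexx orbT.
(* Past [N + nul] every iterate of the window has |C| <= s. *)
exists kap, (maxn J0 (N + nul c)); split.
  by rewrite lt_min !divr_gt0 ?mulr_gt0 ?exprn_gt0.
move=> j; rewrite geq_max => /andP[Jj Nj].
have Ap := a_gt0 (k_ r j).
have Nj' : (N <= j)%N := leq_trans (leq_addr _ _) Nj.
have cs := hN j Nj'; have qp := q0 (leqnn (ra j)).
have [hq|hq] := leP (q j (ra j)) de.
  exists j; split=> //; first by rewrite -addn1 leq_add2l.
  have hs : cn j + q j (ra j) <= eps ^+ 2 / (2 * K ^+ 2).
    have -> : eps ^+ 2 / (2 * K ^+ 2) = de + de by rewrite deE; field; rewrite gt_eqF.
    by rewrite lerD// (le_trans cs).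
  apply: le_trans (f_next_large_gam Jj hs) _; rewrite lerD2l lerN2.
  apply: le_trans (_ : _ <= eps ^+ 2 / (2 * K) / G * A j) _.
    by rewrite ler_pM2r.
  rewrite -mulrA ler_pM2l ?divr_gt0 ?mulr_gt0 ?exprn_gt0//.
  by rewrite mulrC ler_pdivrMr// mulrC ler_pdivlMr ?gP// hG.
(* Bounded gamma: [pred_t] is at least the fixed amount [T], so small |C| puts the tangential test
   in force and acceptance includes the Lagrangian test. *)
have hpt := pt_rej Jj.
have Tpt : T <= pt j (ra j).
  by apply: le_trans hpt; rewrite TE ler_pM2l ?divr_gt0 ?exprn_gt0// ltW.
have hpc : pc j (ra j) <= K ^+ 2 * s.
  apply: le_trans (pred_c_upper (bnd (leqnn _))) _.
  rewrite (expr2 K) -(mulrA K) ler_pM2l// mulrC ler_pM ?sqr_ge0 ?(ltW qp)//.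
    exact: gamV_bound (bnd (leqnn _)).
  rewrite expr2 -[s]mul1r ler_pM ?enorm_ge0// ?(le_trans cs)//.
have test : tangential_test F C c r j (ra j).
  rewrite /tangential_test ge_max -andbA; apply/and3P; split.
  - apply: le_trans hpc _; apply: le_trans Tpt.
    by rewrite mulrC -ler_pdivlMr ?exprn_gt0.
  - apply: le_trans Tpt; apply: le_trans (_ : _ <= (T `^ (xi c)^-1) `^ xi c) _.
      apply: ge0_ler_powR; rewrite ?nnegrE ?(ltW x0) ?pc0 ?(ltW Tx0)//.
      by apply: le_trans hpc _; rewrite mulrC -ler_pdivlMr ?exprn_gt0.
    by rewrite -powRrM mulVf ?gt_eqF// powRr1 ?(ltW T0).
  have := pred_l_dist (bnd (leqnn (ra j))); rewrite ler_distl => /andP[hpl _].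
  have h1 : K * (cn j * q j (ra j)) <= (1 - rho2 c) * (eps ^+ 2 / K * q j (ra j)).
    have -> : (1 - rho2 c) * (eps ^+ 2 / K * q j (ra j)) =
        K * ((1 - rho2 c) * eps ^+ 2 / K ^+ 2 * q j (ra j)).
      by field; rewrite !gt_eqF ?gP.
    by rewrite ler_pM2l// ler_pM2r// (le_trans cs).
  have h2 : (1 - rho2 c) * (eps ^+ 2 / K * q j (ra j)) <= (1 - rho2 c) * pt j (ra j).
    by rewrite ler_pM2l ?subr_gt0.
  lra.
have /andP[_] := accepted_rej j; rewrite test /= /rared_l -x_next => hL.
have [l [lj jl hl]] := window_max_l j; exists l; split=> //.
have hpl : D <= rho1 c * pl j (ra j).
  rewrite DE -mulrA ler_pM2l//; have /andP[_] := test; apply: le_trans.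
  by rewrite ler_pM2l.
have Nl : (N <= l)%N by rewrite -(leq_add2r (nul c)) (leq_trans Nj)// ltnW.
have cl : ky * cn l <= ky * s by rewrite ler_pM2l// hN.
have cj1 : ky * cn j.+1 <= ky * s by rewrite ler_pM2l// hN// leqW.
have hs : ky * s <= D / 4.
  have -> : D / 4 = ky * (D / (4 * ky)) by field; rewrite gt_eqF.
  by rewrite ler_pM2l.
have := dotv_y_C_le l l; rewrite ler_norml => /andP[_ hyl].
have := dotv_y_C_le j j.+1; rewrite ler_norml => /andP[hyj _].
have hkap : kap * A j <= D / 2.
  apply: le_trans (_ : _ <= D / 2 / a_ c 0%N * A j) _; first by rewrite ler_pM2r.
  by rewrite mulrAC ler_pdivrMr// ler_pM2l ?divr_gt0// a_le0.
move: hL hl; rewrite /lagrangian => hL hl.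
lra.
Unshelve. all: by end_near. Qed.

(** Each [a_ k] is charged to the iteration at which [k_] passes from k to k + 1; the other
    iterations add positive terms. *)
Lemma sum_A_ge N J : (N <= J)%N ->
  \sum_(k_ r N <= k < k_ r J) a_ c k <= \sum_(N <= j < J) A j.
Proof.
move=> /subnKC <-; elim: (J - N)%N => [|n IH].
  by rewrite addn0 !big_geq.
rewrite addnS big_nat_recr ?leq_addr//= k_next; case: ifP => _.
  by rewrite big_nat_recr ?k_mono ?leq_addr//= lerD2r.
by apply: le_trans IH _; rewrite lerDl ltW ?a_gt0.
Qed.

Lemma not_bounded_away : False.
Proof.
have [kap [N [kap0 hf]]] := f_window_descent.
have [_ _ _ _ [_ nul0 _ /andP[al0 al1] [/andP[et1 _] [_ _ _ asum]]]] := cP.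
have al01 : 0 < alpha0 c <= 1 by rewrite al0 ltW.
have f0 j : 0 <= f j by rewrite /half_sq mulr_ge0 ?invr_ge0 ?sqr_ge0.
have A0 j : 0 < A j := a_gt0 _.
have [M hM] := window_descent_unbounded nul0 al01 kap0 A0 A_ratio f0 hf.
have et1' : 1 <= Defs.eta c by apply: le_trans (ltW et1); rewrite ler_pdivlMr// mul1r ler_nat.
have [k hk] := sum_powR_unbounded et1' a_gt0 a_le0 asum (k_ r N) M.
have [J kJ] := k_unbounded k.
have hJ := le_trans (sum_A_ge (leq_maxl N J)) (hM _).
move: hk; rewrite ltNge => /negP; apply; apply: le_trans hJ.
have [Nk|kN] := leqP (k_ r N) k; last first.
  by rewrite big_geq ?(ltnW kN)// sumr_ge0// => i _; rewrite ltW ?a_gt0.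
have kJ' : (k <= k_ r (maxn N J))%N by rewrite (leq_trans kJ)// k_mono// leq_maxr.
rewrite [leRHS](big_cat_nat Nk kJ')/= lerDl sumr_ge0// => i _.
by rewrite ltW ?a_gt0.
Qed.

End BoundedAwayRun.

Theorem theorem3p10 (R : realType) (d m p : nat)
    (F : 'cV[R]_d -> 'cV[R]_m) (C : 'cV[R]_d -> 'cV[R]_p)
    (c : constants R) (r : run R d p) :
  valid_constants m c ->
  lm_run F C c r ->
  assumption_A1 r ->
  assumption_A2 F C ->
  assumption_A3 C r ->
  assumption_A4 r ->
  limn_einf (fun j : nat => (enorm (ghat F C r j (rej r j)))%:E) = 0%E.
Proof.
move=> cP rP A1 A2 A3 A4; apply: limn_einf_eq0 => [j|eps eps0 N].
  exact: enorm_ge0.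
have [K K1 bnd] := trial_boundsP cP rP A1 A2 A3 A4.
have [ky [ky0 kyP]] := A4.
(* If no index from [N] on has a value below eps, then [N] serves as the index after which [ghat] is
   bounded away from zero. *)
apply: contrapT => hn; apply: (not_bounded_away cP rP K1 bnd ky0 kyP eps0 (J0 := N)).
by move=> j Nj; rewrite leNgt; apply/negP => hj; apply: hn; exists j.
Qed.
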